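(* Let $\Sigma\subset\mathbb R^2$ be a damping set and $p\in[1,+\infty)$. Assume that there exist positive constants $M,a,b$ such that $a|x|\le|y|\le b|x|$ for every $(x,y)\in\Sigma\setminus B(0,M)$. Assume moreover that the wave equation associated with $\Sigma$ is UGAS in $\mathsf X_\infty$ with some rate $\beta$. Then it is also UGAS in $\mathsf X_p$.
   Context: Notation: $\mathbb R_+=[0,+\infty)$, $R=\begin{pmatrix}\frac1{\sqrt2}&\frac1{\sqrt2}\\-\frac1{\sqrt2}&\frac1{\sqrt2}\end{pmatrix}$ and $R\Sigma=\{R\xi:\xi\in\Sigma\}$; $B(0,M)$ is the Euclidean ball of $\mathbb R^2$ centered at $0$ of radius $M$. $L^p_{\mathrm{loc}}(a,+\infty)$ is the set of measurable functions whose restriction to $(a,T)$ is in $L^p$ for every $T>a$. For $p\in[1,+\infty]$, $W^{1,p}_*(0,1)=\{u\in L^p(0,1): u'\in L^p(0,1),\ u(0)=0\}$ and $\mathsf X_p=W^{1,p}_*(0,1)\times L^p(0,1)$, with norm $\|(u,v)\|_{\mathsf X_p}^p=2^{-p/2}\int_0^1(|u'+v|^p+|u'-v|^p)\,dx$ if $p<+\infty$ and $\|(u,v)\|_{\mathsf X_\infty}=\frac1{\sqrt2}\max(\|u'+v\|_{L^\infty(0,1)},\|u'-v\|_{L^\infty(0,1)})$. The wave equation associated with $\Sigma$ is: $z_{tt}=z_{xx}$ on $\mathbb R_+\times[0,1]$; $z(t,0)=0$ and $(z_t(t,1),-z_x(t,1))\in\Sigma$ for $t\in\mathbb R_+$;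 $z(0,x)=z_0(x)$, $z_t(0,x)=z_1(x)$ for $x\in[0,1]$. A (weak, global in time) solution in $\mathsf X_p$ with initial condition $(z_0,z_1)\in\mathsf X_p$ is a function $z:\mathbb R_+\times[0,1]\to\mathbb R$ for which there exist $f\in L^p_{\mathrm{loc}}(0,+\infty)$ and $g\in L^p_{\mathrm{loc}}(-1,+\infty)$ such that $z(t,x)=\frac1{\sqrt2}\int_0^{t+x}f+\frac1{\sqrt2}\int_0^{t-x}g$ for all $(t,x)\in\mathbb R_+\times[0,1]$, $z(t,0)=0$ and $(z_t(t,1),-z_x(t,1))\in\Sigma$ for a.e. $t\in\mathbb R_+$, and $z(0,x)=z_0(x)$, $z_t(0,x)=z_1(x)$ for a.e. $x\in[0,1]$; here $z_t(t,x)=\frac{f(t+x)+g(t-x)}{\sqrt2}$ and $z_x(t,x)=\frac{f(t+x)-g(t-x)}{\sqrt2}$. Set $e_p(z)(t)=\|(z(t,\cdot),z_t(t,\cdot))\|_{\mathsf X_p}$. Damping set: $\Sigma$ is a damping set if $(0,0)\in\Sigma$, $xy\ge0$ for every $(x,y)\in\Sigma$, and $R\Sigma$ contains the graph of a universally measurable function $\varphi:\mathbb R\to\mathbb R$ with linear growth ($|\varphi(x)|\le a|x|+b$ for some $a,b\ge0$). A set $M\subset\mathbb R$ is universally measurable if for every Borel probability measure $\nu$ on $\mathbb R$ there exist Borel sets $A\subset M\subset B$ with $\nu(B\setminus A)=0$; $\varphi$ is universally measurable if preimages of Borel sets are universally measurable. (For a damping set, solutions exist for every initial condition in $\mathsf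 X_p$.) UGAS: the wave equation is UGAS (uniformly globally asymptotically stable) in $\mathsf X_p$, with rate $\beta$, if $\beta$ is a $\mathcal{KL}$ function such that $e_p(z)(t)\le\beta(e_p(z)(0),t)$ for all $t\ge0$ and every solution $z$ in $\mathsf X_p$. A $\mathcal{KL}$ function is a continuous $\beta:\mathbb R_+\times\mathbb R_+\to\mathbb R_+$ such that for each $t$, $\beta(\cdot,t)$ is increasing with $\beta(0,t)=0$, and for each $x>0$, $\beta(x,\cdot)$ is decreasing and tends to $0$ at $+\infty$. *)

(* Defs.v *)
From HB Require Import structures.
From mathcomp Require Import all_boot all_order all_algebra.
From mathcomp Require Import all_classical all_reals all_analysis.

Set Implicit Arguments.
Unset Strict Implicit.
Unset Printing Implicit Defensive.

Import Order.TTheory GRing.Theory Num.Theory.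
Import numFieldNormedType.Exports.

Local Open Scope classical_set_scope.
Local Open Scope ring_scope.

(* [lebesgue_measure] lives on the Borel sigma-algebra, so "measurable" means
   Borel measurable; L^p classes are unaffected, every Lebesgue measurable
   function being a.e. equal to a Borel one. *)

Section Sobolev.
Context {R : realType}.
Local Notation mu := (@lebesgue_measure R).

Definition in_Lp (p : \bar R) (D : set R) (f : R -> R) : Prop :=
  (f \_ D : measurableTypeR R -> R) \in Lfun mu p.

Definition in_Lp_loc (p : \bar R) (a : R) (f : R -> R) : Prop :=
  forall T : R, a < T -> in_Lp p `]a, T[ f.

(* phi is in C^1_c(]0,1[) *)
Definition test_function (phi : R -> R) : Prop :=
  [/\ forall x : R, derivable phi x 1,
      continuous (derive1 phi) &
      exists2 K : set R, compact K /\ K `<=` `]0, 1[ &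
        forall x : R, ~ K x -> phi x = 0].

Definition weak_derivative (u w : R -> R) : Prop :=
  mu.-integrable `]0, 1[ (EFin \o w) /\
  forall phi : R -> R, test_function phi ->
    \int[mu]_(x in `]0, 1[) (u x * derive1 phi x) =
    - \int[mu]_(x in `]0, 1[) (w x * phi x).

(* A weak derivative of u on ]0,1[; unique up to a null set when it exists
   (and 0 by convention when it does not). *)
Definition wderiv (u : R -> R) : R -> R :=
  xget (cst 0) [set w | weak_derivative u w].

(* u(0) = 0 in W^{1,p}(0,1): as usual, the value at 0 is that of the
   continuous representative of u on [0,1]. *)
Definition vanishes_at0 (u : R -> R) : Prop :=
  exists u' : R -> R,
    [/\ {within `[0, 1], continuous u'},
        {ae mu, forall x : R, `]0, 1[%classic x -> u x = u' x} &
        u' 0 = 0].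

Definition W1p_star (p : \bar R) (u : R -> R) : Prop :=
  [/\ in_Lp p `]0, 1[ u,
      exists2 w, weak_derivative u w & in_Lp p `]0, 1[ w &
      vanishes_at0 u].

Definition X_space (p : \bar R) (u v : R -> R) : Prop :=
  W1p_star p u /\ in_Lp p `]0, 1[ v.

Definition X_norm (p : \bar R) (u v : R -> R) : \bar R :=
  let I := (`]0, 1[)%classic : set R in
  match p with
  | q%:E =>
      (((2 `^ (- (q / 2)))%R%:E *
        \int[mu]_(x in I)
          (`|wderiv u x + v x| `^ q + `|wderiv u x - v x| `^ q)%R%:E) `^ q^-1%R)%E
  | +oo%E =>
      ((Num.sqrt 2)^-1%R%:E *
       maxe (Lnorm mu +oo (EFin \o ((fun x => wderiv u x + v x)%R \_ I)))
            (Lnorm mu +oo (EFin \o ((fun x => wderiv u x - v x)%R \_ I))))%E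
  | -oo%E => 0%E
  end.

End Sobolev.

Section Wave.
Context {R : realType}.
Local Notation mu := (@lebesgue_measure R).

(* Rotation of R^2 by -pi/4 (it sends (1, 1) to (sqrt 2, 0)). *)
Definition rotation (xi : R * R) : R * R :=
  ((xi.1 + xi.2) / Num.sqrt 2, (- xi.1 + xi.2) / Num.sqrt 2).

Definition universally_measurable_set (M : set R) : Prop :=
  forall nu : probability (measurableTypeR R) R,
  exists A B : set (measurableTypeR R),
    [/\ measurable A, measurable B, A `<=` M, M `<=` B & nu (B `\` A) = 0%E].

Definition universally_measurable_fun (phi : R -> R) : Prop :=
  forall B : set (measurableTypeR R), measurable B ->
    universally_measurable_set (phi @^-1` B).

Definition linear_growth (phi : R -> R) : Prop :=
  exists a b : R, [/\ 0 <= a, 0 <= b & forall x : R, `|phi x| <= a * `|x| + b].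

Definition damping_set (Sigma : set (R * R)) : Prop :=
  [/\ Sigma (0, 0),
      forall x y : R, Sigma (x, y) -> 0 <= x * y &
      exists phi : R -> R,
        [/\ universally_measurable_fun phi, linear_growth phi &
            forall x : R, (rotation @` Sigma) (x, phi x)]].

(* int_a^b f, with the usual sign convention when b < a *)
Definition oriented_int (a b : R) (f : R -> R) : R :=
  if a <= b then \int[mu]_(x in `[a, b]) f x
  else - \int[mu]_(x in `[b, a]) f x.

Definition z_t (f g : R -> R) (t x : R) : R :=
  (f (t + x) + g (t - x)) / Num.sqrt 2.

Definition z_x (f g : R -> R) (t x : R) : R :=
  (f (t + x) - g (t - x)) / Num.sqrt 2.

(* z is a weak global solution in X_p with initial condition (z0, z1), as
   witnessed by f and g.  Values of z outside [0,+oo[ x [0,1] are irrelevant. *)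
Definition wave_solution_with (Sigma : set (R * R)) (p : \bar R)
    (z0 z1 : R -> R) (z : R -> R -> R) (f g : R -> R) : Prop :=
  [/\ in_Lp_loc p 0 f /\ in_Lp_loc p (-1) g,
      forall t x : R, 0 <= t -> 0 <= x <= 1 ->
        z t x = (Num.sqrt 2)^-1 * oriented_int 0 (t + x) f +
                (Num.sqrt 2)^-1 * oriented_int 0 (t - x) g,
      {ae mu, forall t : R, 0 <= t ->
        z t 0 = 0 /\ Sigma (z_t f g t 1, - z_x f g t 1)} &
      {ae mu, forall x : R, 0 <= x <= 1 ->
        z 0 x = z0 x /\ z_t f g 0 x = z1 x}].

(* e_p(z)(t).  It depends on f, g only through z, since z determines f and g
   almost everywhere. *)
Definition energy (p : \bar R) (z : R -> R -> R) (f g : R -> R) (t : R)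
  : \bar R := X_norm p (z t) (z_t f g t).

Definition KL_function (beta : R -> R -> R) : Prop :=
  [/\ {within [set st : R * R | 0 <= st.1 /\ 0 <= st.2],
        continuous (fun st : R * R => beta st.1 st.2)},
      forall x t : R, 0 <= x -> 0 <= t -> 0 <= beta x t,
      forall t : R, 0 <= t -> beta 0 t = 0 /\
        forall x y : R, 0 <= x -> x < y -> beta x t < beta y t &
      forall x : R, 0 < x ->
        (forall s t : R, 0 <= s -> s < t -> beta x t < beta x s) /\
        beta x t @[t --> +oo] --> 0].

(* [fine] is harmless: the energy of a solution in X_p is always finite. *)
Definition UGAS_with_rate (Sigma : set (R * R)) (p : \bar R)
    (beta : R -> R -> R) : Prop :=
  KL_function beta /\
  forall (z0 z1 : R -> R) (z : R -> R -> R) (f g : R -> R),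
    X_space p z0 z1 -> wave_solution_with Sigma p z0 z1 z f g ->
    forall t : R, 0 <= t ->
      (energy p z f g t <= (beta (fine (energy p z f g 0)) t)%:E)%E.

Definition UGAS (Sigma : set (R * R)) (p : \bar R) : Prop :=
  exists beta, UGAS_with_rate Sigma p beta.

End Wave.

(* Main.v *)
Require Import Defs.
From HB Require Import structures.
From mathcomp Require Import all_boot all_order all_algebra.
From mathcomp Require Import all_classical all_reals all_analysis.
From mathcomp Require Import measurable_realfun ess_sup_inf.
From mathcomp Require Import zify ring lra.

(** A wave is carried by one function of one variable.  By d'Alembert's formula
and the condition [z t 0 = 0], [f = - g] almost everywhere on the positive
half-line, and the [X_p]-norm at time [t] of a solution is the [L^p] norm of
[g] on [[t - 1, t + 1]] ([wave_energy_p]).  The condition at [x = 1] says that,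
for almost every [s] in [[-1, 1]], the sequence [n |-> g (s + 2 n)] is a
trajectory of the relation obtained from [Sigma] by a rotation
([trajectory], [wave_trajectories]).

Conversely every trajectory [x] is carried by a wave, the one for which [g] is
the step function equal to [x n] on [[2 n - 1, 2 n + 1[]; its
[X_oo]-norm at time [2 n] is [`|x n|].  Uniform stability in [X_oo] therefore
bounds all trajectories: [`|x n| <= beta `|x 0| (2 n)]
([UGAS_oo_trajectory]).

The sector condition becomes, after rotation, a contraction
[`|y| <= (1 - c) `|x|] of the relation at points where [`|x| > M]
([sector_contraction]).  A trajectory that has made [2 k] steps either stayed
above [M] during the first [k] of them, and shrank geometrically, or
entered [[-M, M]] early enough for [beta M] to act during the last [k].
With [A_k = (1 - c)^k + beta M (2 k) / M], which tends to [0], this gives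
[`|x n| <= A_k `|x 0|] when [`|x 0| > M], because [1 <= `|x 0| / M] there, and
[`|x n| <= min (`|x 0|, beta M (2 k))] otherwise ([trajectory_decay]).  Taking
[p]-th powers and integrating over the trajectories that start in [[-1, 1]]
bounds the [X_p]-norm at time [t], with [k] about [t / 4], by
[A_k e + min (e, 2 beta M (2 k))], where [e] is the norm at time [0].  An
explicit KL function dominates this expression ([Lp_rate], [KL_Lp_rate],
[decay_le_rates]).

The norms of [X_p] are defined through an arbitrarily chosen weak derivative.
Computing them requires that the position of a wave has the expected weak
derivative, which is Fubini's theorem applied to a primitive
([primitive_by_parts]), and that a weak derivative is unique up to a null
set, which is the fundamental lemma of the calculus of variations
([test_orthogonal_ae_eq0], [wderiv_ae]). *)

Set Implicit Arguments.
Unset Strict Implicit.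
Unset Printing Implicit Defensive.

Import Order.TTheory GRing.Theory Num.Theory.
Import numFieldNormedType.Exports.

Local Open Scope classical_set_scope.
Local Open Scope ring_scope.

(** * Translations and reflections of the line *)

Section lebesgue_preserving_maps.
Context {R : realType}.
Local Notation mu := (@lebesgue_measure R).
Implicit Types (phi : R -> R) (c x a b t T : R) (D : set R).

Definition lebesgue_preserving phi : Prop :=
  measurable_fun setT phi /\
  forall A : set R, measurable A -> mu (phi @^-1` A) = mu A.

(** Half-open intervals generate the Borel sets and determine the Lebesgue
measure, so the push-forward of the measure need only be compared on them. *)
Lemma lebesgue_preserving_itv phi : measurable_fun setT phi ->
  (forall a b, mu (phi @^-1` `]a, b]) = mu `]a, b]) ->
  lebesgue_preserving phi.
Proof.
move=> mphi H; split=> // A mA.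
symmetry.
have mphi' : measurable_fun (setT : set (measurableTypeR R))
  (phi : measurableTypeR R -> measurableTypeR R) by [].
pose phim := MeasurableFun.Pack (MeasurableFun.Class
  (isMeasurableFun.Build _ _ _ _ _ mphi')).
apply: (@lebesgue_measure_unique R (pushforward mu phim)) => //.
by move=> X [[u v]] /= _ <-; rewrite /pushforward H.
Qed.

Lemma lebesgue_preserving_shift c : lebesgue_preserving (fun x => x + c).
Proof.
apply: lebesgue_preserving_itv; first exact: measurable_funD.
move=> a b.
have -> : (fun x => x + c) @^-1` `]a, b] = `]a - c, b - c]%classic.
  by apply/seteqP; split=> x /=; rewrite !in_itv/= ltrBlDr lerBrDr.
rewrite !lebesgue_measure_itv/= !lte_fin ltrD2r; case: ifP => // _.
by rewrite -!EFinB; congr (_%:E); ring.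
Qed.

Lemma lebesgue_preserving_reflect c : lebesgue_preserving (fun x => c - x).
Proof.
apply: lebesgue_preserving_itv; first exact: measurable_funB.
move=> a b.
have -> : (fun x => c - x) @^-1` `]a, b] = `[c - b, c - a[%classic.
  by apply/seteqP; split=> x /=; rewrite !in_itv/= => /andP[? ?]; apply/andP; split; lra.
rewrite !lebesgue_measure_itv/= !lte_fin ltrD2l ltrN2; case: ifP => // _.
by rewrite -!EFinB; congr (_%:E); ring.
Qed.

Lemma lebesgue_preserving_ae phi (P : R -> Prop) : lebesgue_preserving phi ->
  {ae mu, forall x, P x} -> {ae mu, forall x, P (phi x)}.
Proof.
move=> [mphi pr] [N [mN N0 sub]].
exists (phi @^-1` N); split => //.
- by rewrite -[X in measurable X]setTI; exact: mphi.
- by rewrite /= pr.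
- by move=> x /= nP; apply: sub.
Qed.

Lemma lebesgue_preserving_preimage phi D : lebesgue_preserving phi ->
  measurable D -> measurable (phi @^-1` D).
Proof. by move=> [mphi _] mD; rewrite -[X in measurable X]setTI; exact: mphi. Qed.

Lemma lebesgue_preserving_measurable_fun phi d (T : measurableType d) D (f : R -> T) :
  lebesgue_preserving phi -> measurable D -> measurable_fun D f ->
  measurable_fun (phi @^-1` D) (f \o phi).
Proof.
move=> pr mD mf; apply: (@measurable_comp _ _ _ _ _ _ D) => //.
  by move=> x /= [y ? <-].
by apply: measurable_funTS; case: pr.
Qed.

Lemma lebesgue_preserving_ge0_integral phi D (f : R -> \bar R) :
  lebesgue_preserving phi -> measurable D -> measurable_fun D f ->
  (forall x, D x -> 0 <= f x)%E ->
  (\int[mu]_(x in D) f x = \int[mu]_(x in phi @^-1` D) f (phi x))%E.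
Proof.
move=> pr mD mf f0.
have [mphi pres] := pr.
rewrite -(@ge0_integral_pushforward _ _ (measurableTypeR R) (measurableTypeR R) R
  phi mphi mu D f mD mf); last first.
  by move=> y /[!inE]; exact: f0.
apply: eq_measure_integral => A mA _.
exact/esym/pres.
Qed.

Lemma lebesgue_preserving_integrable phi D (f : R -> \bar R) :
  lebesgue_preserving phi -> measurable D ->
  mu.-integrable D f -> mu.-integrable (phi @^-1` D) (f \o phi).
Proof.
move=> pr mD /integrableP[mf intf]; apply/integrableP; split.
  exact: lebesgue_preserving_measurable_fun.
have <- : (\int[mu]_(x in D) `|f x| = \int[mu]_(x in phi @^-1` D) `|f (phi x)|)%E.
  apply: (@lebesgue_preserving_ge0_integral phi D (abse \o f)) => //.
  - exact: measurableT_comp.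
  - by move=> x _; exact: abse_ge0.
exact: intf.
Qed.

Lemma lebesgue_preserving_integral phi D (f : R -> \bar R) :
  lebesgue_preserving phi -> measurable D -> measurable_fun D f ->
  (\int[mu]_(x in D) f x = \int[mu]_(x in phi @^-1` D) f (phi x))%E.
Proof.
move=> pr mD mf; rewrite integralE [RHS]integralE; congr (_ - _)%E.
- rewrite (lebesgue_preserving_ge0_integral pr)//; last exact: measurable_funepos.
  by apply: eq_integral => x _; rewrite !funeposE.
- rewrite (lebesgue_preserving_ge0_integral pr)//; last exact: measurable_funeneg.
  by apply: eq_integral => x _; rewrite !funenegE.
Qed.

Lemma lebesgue_preserving_Rintegral phi D (f : R -> R) :
  lebesgue_preserving phi -> measurable D -> measurable_fun D f ->
  \int[mu]_(x in D) f x = \int[mu]_(x in phi @^-1` D) f (phi x).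
Proof.
move=> pr mD mf; rewrite /Rintegral (lebesgue_preserving_integral pr)//.
exact/measurable_EFinP.
Qed.

End lebesgue_preserving_maps.

(** * Integrals and almost everywhere statements *)

Section ae_integration.
Context {R : realType}.
Local Notation mu := (@lebesgue_measure R).
Implicit Types (c x a b t T : R) (D : set R).

Lemma ae_mono (P Q : R -> Prop) : {ae mu, forall x, P x} ->
  (forall x, P x -> Q x) -> {ae mu, forall x, Q x}.
Proof.
move=> aeP PQ; apply: negligibleS aeP => x /= nQ Px; exact/nQ/PQ.
Qed.

Lemma ae_mono2 (P Q S : R -> Prop) : {ae mu, forall x, P x} ->
  {ae mu, forall x, Q x} ->
  (forall x, P x -> Q x -> S x) -> {ae mu, forall x, S x}.
Proof.
move=> aeP aeQ PQ.
have := negligibleU aeP aeQ; apply: negligibleS => x /= nS.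
by apply: contrapT => /not_orP[/contrapT ? /contrapT ?]; exact/nS/PQ.
Qed.

(** A set of full measure is dense: its complement, being null, contains no
interval. *)
Lemma ae_exists_itv a b (P : R -> Prop) : {ae mu, forall x, P x} -> a < b ->
  exists2 x, a < x < b & P x.
Proof.
move=> aeP ab; apply: contrapT => nex.
have : mu.-negligible (`]a, b[%classic : set R).
  apply: negligibleS aeP => x /=; rewrite in_itv/= => xab Px.
  by apply: nex; exists x.
move/negligibleP => /(_ (measurable_itv _)) /=.
rewrite lebesgue_measure_itv/= lte_fin ab -EFinB => -[] /eqP.
by rewrite subr_eq0 gt_eqF.
Qed.

Lemma integrable_add D (h k : R -> R) : measurable D ->
  mu.-integrable D (EFin \o h) -> mu.-integrable D (EFin \o k) ->
  mu.-integrable D (EFin \o (fun x => h x + k x)).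
Proof.
move=> mD ih ik.
have := @integrableD _ _ R mu D mD _ _ ih ik.
by congr (mu.-integrable D _); apply/funext => x; rewrite /= EFinD.
Qed.

Lemma integrable_sub D (h k : R -> R) : measurable D ->
  mu.-integrable D (EFin \o h) -> mu.-integrable D (EFin \o k) ->
  mu.-integrable D (EFin \o (fun x => h x - k x)).
Proof.
move=> mD ih ik.
have := @integrableB _ _ R mu D mD _ _ ih ik.
by congr (mu.-integrable D _); apply/funext => x; rewrite /= EFinB.
Qed.

Lemma ge0_integral_itv_split a b c (h : R -> \bar R) : a <= b -> b <= c ->
  measurable_fun (`]a, c[%classic : set R) h -> (forall x, 0 <= h x)%E ->
  (\int[mu]_(x in `]a, c[) h x = \int[mu]_(x in `]a, b[) h x + \int[mu]_(x in `]b, c[) h x)%E.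
Proof.
rewrite le_eqVlt => /predU1P[<- _ _ _|ab bc mh h0].
  by rewrite set_itvoo0 integral_set0 add0e.
have mS i : measurable_fun ([set` i] `&` `]a, c[ : set R) h by exact: measurable_funS mh.
rewrite (@itv_bndbnd_setU _ _ (BRight a) (BLeft b) (BLeft c)) ?bnd_simp//.
rewrite ge0_integral_setU//=; last 2 first.
- by rewrite -itv_bndbnd_setU ?bnd_simp//.
- apply/disj_setPS => y [/=]; rewrite 2!in_itv/= => /andP[_ yb] /andP[].
  by rewrite leNgt yb.
congr (_ + _)%E; apply/esym/integral_itv_obnd_cbnd.
apply: measurable_funS mh => // y /=; rewrite !in_itv/= => /andP[by' ->].
by rewrite (lt_trans ab).
Qed.

End ae_integration.

(** * Lebesgue spaces *)

Section lebesgue_spaces.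
Context {R : realType}.
Local Notation mu := (@lebesgue_measure R).
Implicit Types (c x a b t T p : R) (D : set R).

Lemma powR_ge_self p (y : R) : 1 <= p -> 0 <= y -> y <= 1 + y `^ p.
Proof.
move=> p1 y0; have [y1|y1] := leP y 1; first by rewrite ler_wpDr ?powR_ge0.
rewrite ler_wpDl// -[leLHS]powRr1//.
by apply: ler_powR => //; exact: ltW.
Qed.

Lemma in_Lp_measurable (q : \bar R) D (h : R -> R) : measurable D ->
  in_Lp q D h -> measurable_fun D h.
Proof.
move=> mD; rewrite /in_Lp inE => /andP[/[!inE]/= mh _].
by apply/(measurable_restrictT _ mD).
Qed.

Lemma in_Lp_integrable_powR p D (h : R -> R) : 1 <= p -> measurable D ->
  in_Lp p%:E D h -> mu.-integrable D (fun x => (`|h x| `^ p)%:E).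
Proof.
move=> p1 mD hp; have := Lfun_integrable p1 hp.
have -> : (fun x => (`|(h \_ D) x| `^ p)%:E) = (fun x => (`|h x| `^ p)%:E) \_ D.
  apply/funext => x; rewrite !patchE; case: ifPn => // _.
  by rewrite normr0 powR0// gt_eqF// (lt_le_trans ltr01).
by move/(integrable_restrict mu mD measurableT _).2; rewrite setTI.
Qed.

Lemma lebesgue_itvoo_lty a b : (mu `]a, b[%classic < +oo)%E.
Proof. by rewrite lebesgue_measure_itv/=; case: ifP => _; rewrite ?ltry// -EFinB ltry. Qed.

(** On a bounded interval [L^p] is contained in [L^1], since [y <= 1 + y^p] for
nonnegative [y]. *)
Lemma in_Lp_integrable p a b (h : R -> R) : 1 <= p ->
  in_Lp p%:E `]a, b[ h -> mu.-integrable `]a, b[ (EFin \o h).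
Proof.
move=> p1 hp; have mI : measurable (`]a, b[%classic : set R) by exact: measurable_itv.
have mh := in_Lp_measurable mI hp; have ih := in_Lp_integrable_powR p1 mI hp.
have i1 : mu.-integrable `]a, b[ (cst 1%:E).
  apply/integrableP; split; first exact: measurable_cst.
  under eq_integral do rewrite /= normr1. rewrite integral_cst// mul1e.
  exact: lebesgue_itvoo_lty.
have := @integrableD _ _ R mu _ mI _ _ i1 ih.
apply: le_integrable => //; first exact/measurable_EFinP.
move=> x _; rewrite /= lee_fin [leRHS]ger0_norm ?addr_ge0 ?powR_ge0//.
exact: powR_ge_self.
Qed.

Lemma measurable_norm_powR p (d : measure_display) (aT : measurableType d)
    (A : set aT) (h : aT -> R) :
  measurable_fun A h -> measurable_fun A (fun u => `|h u| `^ p).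
Proof.
move=> mh; apply: (measurableT_comp (measurable_powR _)).
exact: measurableT_comp.
Qed.

Lemma measurable_norm_powR_EFin p (d : measure_display) (aT : measurableType d)
    (A : set aT) (h : aT -> R) :
  measurable_fun A h -> measurable_fun A (fun u => (`|h u| `^ p)%:E).
Proof. by move=> mh; apply/measurable_EFinP; exact: measurable_norm_powR. Qed.

Lemma lebesgue_setT_gt0 : (0 < mu setT)%E.
Proof.
apply: (@lt_le_trans _ _ (mu `]0, 1[%classic)).
  by rewrite lebesgue_measure_itv/= lte_fin ltr01 -EFinB lte_fin subr0.
by apply: le_measure => //; rewrite inE//=.
Qed.

Lemma Lnorm_oo_ess_sup (h : R -> R) :
  Lnorm mu +oo%E (EFin \o h) = ess_sup mu (abse \o (EFin \o h)).
Proof. by rewrite unlock lebesgue_setT_gt0. Qed.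

Lemma bounded_in_Loo D (h : R -> R) (C : R) : 0 <= C -> measurable D ->
  measurable_fun D h -> (forall x, D x -> `|h x| <= C) -> in_Lp +oo%E D h.
Proof.
move=> C0 mD mh hC; rewrite /in_Lp inE; apply/andP; split; rewrite inE/=.
  exact/(measurable_restrictT _ mD).
rewrite /finite_norm Lnorm_oo_ess_sup.
apply: (@le_lt_trans _ _ C%:E); last exact: ltry.
apply/ess_supP; apply: aeW => x; rewrite /= lee_fin patchE; case: ifPn => [|_].
  by rewrite inE; exact: hC.
by rewrite normr0.
Qed.

(** The extension by zero outside the interval does not increase the essential
supremum, and the value [k] is attained on a set of positive measure. *)
Lemma Lnorm_oo_cst (h : R -> R) (k : R) :
  {ae mu, forall x, 0 < x < 1 -> h x = k} ->
  Lnorm mu +oo%E (EFin \o (h \_ `]0, 1[)) = `|k|%:E.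
Proof.
move=> hk; rewrite Lnorm_oo_ess_sup; apply/eqP; rewrite eq_le; apply/andP; split.
  apply/ess_supP; apply: (ae_mono hk) => x Hx; rewrite /= lee_fin patchE.
  case: ifPn => [|_]; last by rewrite normr0.
  by rewrite inE/= in_itv/= => /Hx ->.
have H2 := ess_sup_ge mu (abse \o (EFin \o (h \_ `]0, 1[))).
have [x x01 [hx]] := ae_exists_itv (ae_mono2 hk H2 (fun _ u v => conj u v)) ltr01.
by rewrite /= patchE mem_set/= ?in_itv// hx.
Qed.

End lebesgue_spaces.

(** * Functions with vanishing primitive *)

Section vanishing_primitive.
Context {R : realType}.
Local Notation mu := (@lebesgue_measure R).
Implicit Types (c x a b t T : R) (D : set R).

(** By Lebesgue's differentiation theorem the primitive [F] of [h] is
differentiable with derivative [h] almost everywhere.  As [F] vanishes on a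
dense set only, rather than everywhere, both the value and the derivative of
[F] at a differentiability point are read along zeros of [F]. *)
Lemma primitive_eq0_ae a b (h : R -> R) :
  mu.-integrable `]a, b[ (EFin \o h) ->
  {ae mu, forall x, a < x < b -> \int[mu]_(y in `]a, x]) h y = 0} ->
  {ae mu, forall x, a < x < b -> h x = 0}.
Proof.
move=> ih H.
pose h' := h \_ `]a, b[.
have ih' D : measurable D -> mu.-integrable D (EFin \o h').
  move=> mD; apply: (@integrableS _ _ _ _ setT) => //.
  rewrite /h' -restrict_EFin; apply/integrable_restrict => //.
  by rewrite setTI.
have loch : locally_integrable [set: R] h'.
  exact: integrable_locally.
have := @FTC1 R h' (BRight a) (fun y => ih' _ (measurable_itv _)) loch.
set F := fun x => _.
move=> /= H1.
have H2 : {ae mu, forall x, a < x < b -> F x = 0}.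
  apply: (ae_mono H) => x /= Hx xab; rewrite -(Hx xab) /F.
  apply: eq_Rintegral => y; rewrite inE/= in_itv/= => /andP[ay yx].
  by rewrite /h' patchE ifT// inE/= in_itv/= ay (le_lt_trans yx)//; case/andP: xab.
apply: (ae_mono H1) => x Fx xab.
have /Fx[dF hx] : (BRight a < BRight x)%O by rewrite bnd_simp; case/andP: xab.
(* zeros of [F] accumulate at [x] from the right *)
have freq (d : R) : 0 < d -> exists2 y, x < y < x + d & F y = 0.
  move=> d0.
  have [|y /andP[xy yd] Fy] := @ae_exists_itv R x (Num.min (x + d) b) _ H2.
    by rewrite lt_min ltrDl d0; case/andP: xab.
  move: yd; rewrite lt_min => /andP[yd yb].
  exists y; first by rewrite xy yd.
  by apply: Fy; rewrite yb andbT; case/andP: xab => /lt_trans ->.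
have Fx0 : F x = 0.
  apply: contrapT => /eqP Fx0.
  have cF : {for x, continuous F} by exact/differentiable_continuous/derivable1_diffP.
  have /cF [d /= d0 Hd] : nbhs (F x) [set y | y != 0].
    by apply: open_nbhs_nbhs; split => //; exact: open_neq.
  have [y /andP[xy yd] Fy] := freq _ d0.
  have /= := Hd y; rewrite Fy eqxx => K.
  suff : false by []. apply: K.
  by rewrite ltr0_norm ?subr_lt0// opprB ltrBlDl.
have -> : h x = derive1 F x.
  by rewrite hx /h' patchE ifT// inE/= in_itv.
rewrite derive1E; apply: contrapT => /eqP D0.
have := dF; rewrite /derivable => cvgF.
have /cvgF [d /= d0 Hd] : nbhs (lim (e^-1 *: (F (e *: 1 + x) - F x) @[e --> 0^'])) [set y | y != 0].
  apply: open_nbhs_nbhs; split; first exact: open_neq.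
  by move: D0 => /=; congr (_ != _); congr (lim _).
have [y /andP[xy yd] Fy] := freq _ d0.
have /= := Hd (y - x).
rewrite [_ *: 1]mulr1 subrK Fx0 Fy subrr scaler0 eqxx => K.
suff : false by []. apply: K.
  by rewrite sub0r normrN gtr0_norm ?subr_gt0// ltrBlDl.
by rewrite subr_eq0 gt_eqF.
Qed.

End vanishing_primitive.

(** * Smooth approximations of indicators of intervals *)

Section plateau_functions.
Context {R : realType}.
Implicit Types c x a : R.

(** The square of the positive part, the simplest function of class [C^1] that
vanishes exactly on a half-line. *)
Definition sqpos (y : R) : R := Num.max 0 y ^+ 2.

(** A quadratic remainder, uniform in [x], avoids a separate study of the
differentiability at [0]. *)
Lemma sqpos_taylor (x h : R) :
  `|sqpos (h + x) - sqpos x - 2 * Num.max 0 x * h| <= h ^+ 2.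
Proof.
rewrite /sqpos ler_norml; case: (leP 0 x) => x0; case: (leP 0 (h + x)) => hx; apply/andP; split; nra.
Qed.

Lemma is_derive_sqpos (x : R) : is_derive x 1 sqpos (2 * Num.max 0 x).
Proof.
have H : h^-1 *: (sqpos (h *: 1 + x) - sqpos x) @[h --> 0^'] --> 2 * Num.max 0 x.
  apply/cvgrPdist_le => /= e e0.
  near=> h.
  have h0 : h != 0 by near: h; exact: nbhs_dnbhs_neq.
  have he : `|h| <= e.
    near: h; apply: nbhs_dnbhs; exists e => //= z /=.
    by rewrite sub0r normrN => /ltW.
  have := sqpos_taylor x h.
  rewrite [_ *: 1]mulr1 => T.
  apply: le_trans he.
  have -> : `|2 * Num.max 0 x - h^-1 *: (sqpos (h + x) - sqpos x)| =
            `|h|^-1 * `|sqpos (h + x) - sqpos x - 2 * Num.max 0 x * h|.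
    rewrite -normfV -normrM distrC; congr (`|_|).
    by rewrite /GRing.scale/=; field.
  by rewrite ler_pdivrMl ?normr_gt0// -normrM -expr2 (ger0_norm (sqr_ge0 h)).
by split; [exact: cvgP H | apply/cvg_lim].
Unshelve. all: by end_near. Qed.

(** For [c <= a], a function of class [C^1] that increases with [n] to the indicator
of [`]c, a[]: it is [v / (1 + v)] with [v] equal to [n] times the square of the
positive part of [(x - c) (a - x)]. *)
Definition plateau c a (n : nat) (x : R) : R :=
  1 - (1 + n%:R * sqpos ((x - c) * (a - x)))^-1.

Lemma sqpos_ge0 (y : R) : 0 <= sqpos y. Proof. exact: sqr_ge0. Qed.

Lemma plateau_den_gt0 (n : nat) (y : R) : 0 < 1 + n%:R * sqpos y.
Proof. by rewrite ltr_pwDl// mulr_ge0// sqpos_ge0. Qed.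

Lemma plateau_itv c a n x : 0 <= plateau c a n x <= 1.
Proof.
rewrite /plateau subr_ge0 lerBlDr lerDl invr_ge0; apply/andP; split; last first.
  exact/ltW/plateau_den_gt0.
by rewrite invf_le1 ?plateau_den_gt0// lerDl mulr_ge0// sqpos_ge0.
Qed.

Lemma plateau_out c a n x : ~ (c < x < a) -> c <= a -> plateau c a n x = 0.
Proof.
move=> xca ca; rewrite /plateau (_ : sqpos _ = 0) ?mulr0 ?addr0 ?invr1 ?subrr//.
rewrite /sqpos max_l ?expr0n//.
have [xc|cx] := leP x c; first by nra.
have [ax|xa] := leP a x; first by nra.
by exfalso; apply: xca; rewrite cx xa.
Qed.

Definition dplateau c a (n : nat) (x : R) : R :=
  (1 + n%:R * sqpos ((x - c) * (a - x))) ^- 2 *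
  (n%:R * (2 * Num.max 0 ((x - c) * (a - x)) * ((a - x) - (x - c)))).

Lemma is_derive_plateau c a n x : is_derive x 1 (plateau c a n) (dplateau c a n x).
Proof.
pose q := fun x : R => (x - c) * (a - x).
have dq : is_derive x 1 q ((a - x) - (x - c)).
  have -> : q = (id - cst c) * (cst a - id) by [].
  apply: is_derive_eq; rewrite /GRing.scale/= !fctE/=. ring.
pose s := sqpos \o q.
have ds : is_derive x 1 s (2 * Num.max 0 (q x) * ((a - x) - (x - c))).
  by apply: is_derive1_comp; exact: is_derive_sqpos.
pose D := cst 1 + n%:R \*: s.
have dD : is_derive x 1 D (n%:R * (2 * Num.max 0 (q x) * ((a - x) - (x - c)))).
  by apply: is_derive_eq; rewrite add0r.
have -> : plateau c a n = cst 1 - (fun y => (D y)^-1) by [].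
have dDV := @is_deriveV R D x _ 1 (lt0r_neq0 (plateau_den_gt0 n (q x))) dD.
apply: is_derive_eq.
by rewrite sub0r /GRing.scale/= mulNr opprK.
Qed.

Lemma continuous_dplateau c a n : continuous (dplateau c a n).
Proof.
have cq : continuous (fun x : R => (x - c) * (a - x)).
  by move=> x; apply: cvgM; apply: cvgB => //; exact: cvg_cst.
have cm : continuous (fun x : R => Num.max 0 ((x - c) * (a - x))).
  by move=> x; apply: (@continuous_max R R (cst 0) _ x); [exact: cvg_cst|exact: cq].
move=> x; apply: cvgM.
  apply: cvgV; first by rewrite expf_neq0// lt0r_neq0// plateau_den_gt0.
  apply: cvgM; (apply: cvgD; [exact: cvg_cst|apply: cvgM; [exact: cvg_cst|apply: cvgM; exact: cm]]).
apply: cvgM; first exact: cvg_cst.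
apply: cvgM; first by apply: cvgM; [exact: cvg_cst|exact: cm].
by apply: cvgB; apply: cvgB => //; exact: cvg_cst.
Qed.

Lemma test_function_plateau c a n : 0 < c -> c <= a -> a < 1 ->
  test_function (plateau c a n).
Proof.
move=> c0 ca a1; split.
- by move=> x; case: (is_derive_plateau c a n x).
- have -> : derive1 (plateau c a n) = dplateau c a n.
    by apply/funext => x; rewrite derive1E; case: (is_derive_plateau c a n x).
  exact: continuous_dplateau.
- exists `[c, a]%classic.
    split; first exact: segment_compact.
    move=> x /=; rewrite !in_itv/= => /andP[cx xa].
    by rewrite (lt_le_trans c0)// (le_lt_trans xa).
  move=> x /= xca; apply: plateau_out => // /andP[cx xa]; apply: xca.
  by rewrite in_itv/= !ltW.
Qed.

Lemma plateau_cvg c a x : c < x < a -> plateau c a n x @[n --> \oo] --> (1 : R).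
Proof.
move=> /andP[cx xa].
have q0 : 0 < (x - c) * (a - x) by rewrite mulr_gt0// subr_gt0.
have s0 : 0 < sqpos ((x - c) * (a - x)) by rewrite /sqpos max_r ?ltW// exprn_gt0.
rewrite -[X in _ --> X]subr0; apply: cvgB; first exact: cvg_cst.
apply/gtr0_cvgV0; first by near=> n; exact: plateau_den_gt0.
apply/cvgryPge => A; near=> n.
rewrite -lerBlDl -ler_pdivrMr//.
by near: n; exact: nbhs_infty_ger.
Unshelve. all: by end_near. Qed.

End plateau_functions.

(** * Uniqueness of weak derivatives *)

Section weak_derivative_uniqueness.
Context {R : realType}.
Local Notation mu := (@lebesgue_measure R).
Implicit Types (c x a b t T : R) (D : set R).

Lemma bounded_continuous_itv01 (h : R -> R) : continuous h ->
  [bounded h x | x in (`]0, 1[%classic : set R)].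
Proof.
move=> ch.
have : bounded_set (h @` `[0, 1]%classic).
  apply: compact_bounded; apply: continuous_compact; last exact: segment_compact.
  exact: continuous_subspaceT.
move=> [M [Mr HM]]; exists M; split => // y My x /= x01.
apply: (HM y My); exists x => //.
by move: x01; rewrite /= !in_itv/= => /andP[/ltW-> /ltW->].
Qed.

Lemma integrable_mul_continuous (w h : R -> R) : continuous h ->
  mu.-integrable `]0, 1[ (EFin \o w) ->
  mu.-integrable `]0, 1[ (EFin \o (fun x => w x * h x)).
Proof.
move=> ch iw.
have -> : EFin \o (fun x => w x * h x) = ((EFin \o w) \* (EFin \o h))%E by [].
apply: integrableMl => //; last exact: bounded_continuous_itv01.
by apply: measurable_funTS; apply: continuous_measurable_fun.
Qed.

Lemma test_function_continuous (phi : R -> R) : test_function phi -> continuous phi.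
Proof.
by move=> [dphi _ _] x; apply/differentiable_continuous/derivable1_diffP.
Qed.

(** Testing against plateau functions and passing to the limit by dominated
convergence shows that the integral of [w] over every compact subinterval
vanishes, hence so do the primitives of [w]. *)
Lemma test_orthogonal_ae_eq0 (w : R -> R) : mu.-integrable `]0, 1[ (EFin \o w) ->
  (forall phi, test_function phi -> \int[mu]_(x in `]0, 1[) (w x * phi x) = 0) ->
  {ae mu, forall x, 0 < x < 1 -> w x = 0}.
Proof.
move=> iw H.
have mw : measurable_fun (`]0, 1[%classic : set (measurableTypeR R)) w.
  by apply/measurable_EFinP; exact: (measurable_int mu).
(* supports must stay away from 0: work on intervals exhausting ]0, 1[ *)
suff Hn n : {ae mu, forall x, n.+2%:R^-1 < x < 1 -> w x = 0}.
  have := ae_foralln Hn; move=> Hn'; apply: (ae_mono Hn') => x {}Hn /andP[x0 x1].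
  have [n /= nx] : exists n : nat, n.+2%:R^-1 < x.
    exists (Num.truncn x^-1); rewrite invf_plt ?posrE//.
    by rewrite (lt_trans (truncnS_gt _))// ltr_nat.
  by apply: (Hn n); rewrite nx.
set c : R := n.+2%:R^-1.
have c0 : 0 < c by rewrite invr_gt0.
have ac01 a : c < a -> a < 1 -> `]c, a[ `<=` (`]0, 1[%classic : set R).
  move=> ca a1 x /=; rewrite !in_itv/= => /andP[cx xa].
  by rewrite (lt_trans c0)//= (lt_trans xa).
apply: (@primitive_eq0_ae _ _ _ w).
  apply: integrableS iw => //; move=> x /=; rewrite !in_itv/= => /andP[cx ->].
  by rewrite (lt_trans c0).
apply: aeW => a /andP[ca a1].
rewrite -Rintegral_itv_bndo_bndc; last first.
  by apply: integrableS iw => //; exact: ac01.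
pose f_ n x := (w x * plateau c a n x)%:E.
pose f x := ((w \_ `]c, a[) x)%:E.
have [//|||||_ _] := @dominated_convergence _ _ R mu `]0, 1[ (measurable_itv _) f_ f (fun x => `|w x|%:E).
- move=> k; apply/measurable_EFinP; apply: measurable_funM => //.
  apply: measurable_funTS; apply: continuous_measurable_fun.
  by apply/test_function_continuous/test_function_plateau => //; exact/ltW.
- apply/measurable_EFinP; apply/measurable_restrict => //.
  apply: measurable_funS mw => //.
- apply: aeW => x x01; rewrite /f /f_ patchE; case: ifPn => xca.
    apply: cvg_EFin; first by near=> k.
    rewrite -[X in _ --> X]mulr1; apply: cvgM; first exact: cvg_cst.
    by apply: plateau_cvg; move: xca; rewrite inE/= in_itv.
  rewrite (_ : (fun _ => _) = cst 0%:E); first exact: cvg_cst.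
  apply/funext => k; rewrite plateau_out ?mulr0// ?ltW//.
  by move=> K; move: xca; rewrite notin_setE/= in_itv.
- exact: (integrable_norm iw).
- apply: aeW => x k x01; rewrite lee_fin normrM ler_piMr//.
  have /andP[b0 b1] := plateau_itv c a k x.
  by rewrite ger0_norm.
move=> cv.
have : (\int[mu]_(x in `]0%R, 1%R[) f x = 0)%E.
  apply: cvg_unique cv _ => //.
  rewrite (_ : (fun _ => _) = cst 0%E); first exact: cvg_cst.
  apply/funext => k /=.
  have tb : test_function (plateau c a k) by apply: test_function_plateau => //; exact/ltW.
  rewrite -[LHS]fineK.
    by rewrite -[fine _]/(Rintegral mu _ (fun x => w x * plateau c a k x)) H.
  apply: integrable_fin_num => //.
  exact: integrable_mul_continuous (test_function_continuous tb) iw.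
rewrite /f /Rintegral => E0.
rewrite [X in fine X](_ : _ = 0%E)//.
rewrite -E0 [RHS]integral_mkcond [LHS]integral_mkcond; apply: eq_integral => x _.
rewrite !patchE; case: ifPn => xca; case: ifPn => x01 //.
exfalso; move: x01; rewrite notin_setE; apply; move: xca; rewrite inE/=.
by rewrite !in_itv/= => /andP[cx xa]; rewrite (lt_trans c0)//= (lt_trans xa).
Unshelve. all: by end_near. Qed.

End weak_derivative_uniqueness.

(** * Primitives have weak derivatives *)

Section weak_derivative_existence.
Context {R : realType}.
Local Notation mu := (@lebesgue_measure R).
Implicit Types (c x a b t T : R) (D : set R).

Lemma integral_derive1_itvcc a b (phi : R -> R) : a < b ->
  (forall x, derivable phi x 1) -> continuous (derive1 phi) ->
  \int[mu]_(x in `[a, b]) derive1 phi x = phi b - phi a.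
Proof.
move=> ab dphi cphi.
have cf : continuous phi by move=> x; apply/differentiable_continuous/derivable1_diffP.
have cd : {within `[a, b], continuous (derive1 phi)} by exact: continuous_subspaceT.
have dLR : derivable_oo_LRcontinuous phi a b.
  split; first by move=> x _.
  - by apply: cvg_at_right_filter; exact: cf.
  - by apply: cvg_at_left_filter; exact: cf.
by have /(congr1 fine) := continuous_FTC2 ab cd dLR (fun x _ => erefl).
Qed.

(** The kernel that turns the integral of a primitive into an integral over a
product space. *)
Lemma measurable_ge_indic : measurable_fun setT
  (fun z : measurableTypeR R * measurableTypeR R => ((z.2 : R) <= z.1)%R%:R : R).
Proof.
have -> : (fun z : measurableTypeR R * measurableTypeR R =>
    ((z.2 : R) <= z.1)%R%:R : R) = \1_[set z | (z.2 : R) <= z.1].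
  apply/funext => z; rewrite indicE; congr (_%:R).
  apply/esym; case: (boolP ((z.2 : R) <= z.1)) => h; first by rewrite mem_set.
  by rewrite memNset//; apply/negP.
apply: measurable_indic.
rewrite [X in measurable X](_ : _ = (fun z : measurableTypeR R * measurableTypeR R =>
    (z.2 : R) <= z.1) @^-1` [set true]); last first.
  by apply/seteqP; split => z /=.
rewrite -[X in measurable X]setTI.
have := @measurable_fun_ler _ _ R setT
  (fun z : measurableTypeR R * measurableTypeR R => z.2) (fun z => z.1)
  measurable_snd measurable_fst.
by apply.
Qed.

(** Integration by parts for an integrable [w], which has no pointwise derivative
theory to rely on: write the primitive of [w] at [x] as the integral of
[w y] over [y <= x] and exchange the integrals; the inner integral of
[phi'] over [x >= y] is [- phi y] since [phi] vanishes at [1].  The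
integrability of the product is part of the conclusion because it comes from
the same application of Fubini's theorem. *)
Lemma primitive_by_parts (w phi : R -> R) :
  mu.-integrable `]0, 1[ (EFin \o w) -> test_function phi ->
  mu.-integrable `]0, 1[ (EFin \o (fun x => (\int[mu]_(y in `]0, x]) w y) * derive1 phi x)) /\
  \int[mu]_(x in `]0, 1[) ((\int[mu]_(y in `]0, x]) w y) * derive1 phi x) =
  - \int[mu]_(x in `]0, 1[) (w x * phi x).
Proof.
move=> iw tphi; have [dphi cphi [K [_ K01] Kphi]] := tphi.
have phi1 : phi 1 = 0.
  by apply: Kphi => /K01; rewrite /= in_itv/= ltxx andbF.
pose I : set R := `]0, 1[%classic.
pose w' := w \_ I.
pose d' := derive1 phi \_ I.
have mI : measurable I by exact: measurable_itv.
have muI : (mu I < +oo)%E by rewrite /I lebesgue_measure_itv/= lte_fin ltr01 ltry.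
have iw' : mu.-integrable setT (EFin \o w').
  by rewrite /w' -restrict_EFin; apply/integrable_restrict => //; rewrite setTI.
have mw' : measurable_fun setT w'.
  by apply/measurable_EFinP; exact: (measurable_int mu).
have id' : mu.-integrable setT (EFin \o d').
  rewrite /d' -restrict_EFin; apply/integrable_restrict => //; rewrite setTI.
  apply: measurable_bounded_integrable => //.
  - by apply: measurable_funTS; apply: continuous_measurable_fun.
  - exact: bounded_continuous_itv01.
have md' : measurable_fun setT d'.
  by apply/measurable_EFinP; exact: (measurable_int mu).
(* the first variable is that of [phi'], the second that of [w] *)
pose H (z : measurableTypeR R * measurableTypeR R) :=
  (d' z.1 * w' z.2 * ((z.2 : R) <= z.1)%R%:R)%:E.
have mH : measurable_fun setT H.
  apply/measurable_EFinP; apply: measurable_funM; last exact: measurable_ge_indic.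
  apply: measurable_funM; first exact: (measurableT_comp md' measurable_fst).
  exact: (measurableT_comp mw' measurable_snd).
have iH : (mu \x mu)%E.-integrable setT H.
  apply/(integrable12ltyP _ _ mH).
  apply: (@le_lt_trans _ _ (\int[mu]_x (`|d' x|%:E * \int[mu]_y `|w' y|%:E))%E).
    apply: ge0_le_integral => //.
    - by move=> x _; apply: integral_ge0.
    - apply: (measurable_fun_fubini_tonelli_F (abse \o H)) => //=.
      exact: (measurableT_comp (@abse_measurable _ setT) mH).
    - apply: emeasurable_funM; last exact: measurable_cst.
      by apply/measurable_EFinP; exact: measurableT_comp.
    - move=> x _; rewrite -ge0_integralZl//; last first.
        by apply/measurable_EFinP; exact: measurableT_comp.
      apply: ge0_le_integral => //.
      + have mHx := measurableT_comp mH
          (@pair1_measurable _ _ (measurableTypeR R) (measurableTypeR R) x).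
        exact: (measurableT_comp (@abse_measurable _ setT) mHx).
      + by apply: measurable_funeM; apply/measurable_EFinP; exact: measurableT_comp.
      + move=> y _; rewrite /H abse_EFin lee_fin 2!normrM.
        by rewrite ler_piMr ?mulr_ge0// ger0_norm ?ler0n// lern1 leq_b1.
  rewrite ge0_integralZr//; last first.
  - exact: integral_ge0.
  - by apply/measurable_EFinP; exact: measurableT_comp.
  have /integrableP[_ dy] := id'; have /integrableP[_ wy] := iw'.
  by rewrite lte_mul_pinfty ?integral_ge0// ge0_fin_numE ?integral_ge0.
pose P x := \int[mu]_(y in `]0, x]) w y.
have Pint x : I x -> mu.-integrable `]0, x] (EFin \o w).
  move=> Ix; apply: integrableS iw => // y.
  move: Ix; rewrite /I /= !in_itv/= => /andP[x0 x1] /andP[-> yx].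
  exact: le_lt_trans yx x1.
have FE : fubini_F mu H = (EFin \o (fun x => P x * derive1 phi x)) \_ I.
  apply/funext => x; rewrite /fubini_F patchE; case: ifPn => xI; last first.
    by rewrite integral0_eq// => y _; rewrite /H /d' patchE (negbTE xI) !mul0r.
  have {}xI : I x by rewrite inE in xI.
  under eq_integral => y _.
    rewrite (_ : H (x, y) = (derive1 phi x)%:E * (EFin \o (w \_ `]0%R, x])) y)%E; last first.
      rewrite /H /d' /w' !patchE/= mem_set// -EFinM -mulrA; congr (_ * _)%:E.
      move: (xI); rewrite /I/= in_itv/= => /andP[x0 x1].
      rewrite !mem_setE !in_itv/=; have [yx|xy] := leP (y : R) x.
        by rewrite (le_lt_trans yx x1) mulr1 patchE mem_setE in_itv/= yx.
      by rewrite mulr0 patchE mem_setE in_itv/= (leNgt y) xy andbF.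
    over.
  rewrite integralZl//; last first.
    by rewrite -restrict_EFin; apply/integrable_restrict => //; rewrite setTI; exact: Pint.
  rewrite -restrict_EFin -integral_mkcond -(fineK (integrable_fin_num _ (Pint _ xI)))// -EFinM mulrC.
  by [].
have GE : fubini_G mu H = (EFin \o (fun y => - (w y * phi y))) \_ I.
  apply/funext => y; rewrite /fubini_G patchE; case: ifPn => yI; last first.
    by rewrite integral0_eq// => x _; rewrite /H /w' patchE (negbTE yI) mulr0 mul0r.
  have {}yI : I y by rewrite inE in yI.
  have iphi : mu.-integrable `[y, 1[ (EFin \o derive1 phi).
    have : mu.-integrable `[y, 1] (EFin \o derive1 phi).
      apply: continuous_compact_integrable; first exact: segment_compact.
      exact: continuous_subspaceT.
    apply: integrableS => //.
    by move=> x /=; rewrite !in_itv/= => /andP[-> /ltW].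
  under eq_integral => x _.
    rewrite (_ : H (x, y) = (w y)%:E * (EFin \o (derive1 phi \_ `[y, 1%R[)) x)%E; last first.
      rewrite /H /d' /w' !patchE/= (mem_set yI) mulrAC mulrC -EFinM; congr (_ * _)%:E.
      move: (yI); rewrite /I/= in_itv/= => /andP[y0 y1].
      rewrite !mem_setE !in_itv/=; have [yx|xy] := leP (y : R) x.
        by rewrite (lt_le_trans y0 yx)/= mulr1 patchE mem_setE in_itv/= yx.
      by rewrite mulr0 patchE mem_setE in_itv/= leNgt xy.
    over.
  rewrite integralZl//; last first.
    by rewrite -restrict_EFin; apply/integrable_restrict => //; rewrite setTI.
  rewrite -restrict_EFin -integral_mkcond -(fineK (integrable_fin_num _ iphi))// -EFinM.
  rewrite -[fine _]/(\int[mu]_(x in `[y, 1[) derive1 phi x) Rintegral_itv_bndo_bndc//.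
  rewrite integral_derive1_itvcc// ?phi1 ?sub0r ?mulrN//.
  by move: yI; rewrite /I/= in_itv/= => /andP[].
have iF := integrable_fubini_F iH; rewrite FE in iF.
split; first by have := (integrable_restrict mu mI measurableT _).2 iF; rewrite setTI.
have := Fubini iH.
rewrite -[X in X = _ -> _]/(\int[mu]_x fubini_F mu H x)%E FE.
rewrite -[X in _ = X -> _]/(\int[mu]_x fubini_G mu H x)%E GE.
rewrite -!integral_mkcond => /(congr1 fine); rewrite -!/(Rintegral _ _ _) => ->.
rewrite -[LHS]/(\int[mu]_(y in I) (- (w y * phi y))).
under eq_Rintegral do rewrite -mulN1r.
rewrite RintegralZl// ?mulN1r//.
exact: integrable_mul_continuous (test_function_continuous tphi) iw.
Qed.

Lemma weak_derivative_primitive (u w : R -> R) (C : R) :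
  mu.-integrable `]0, 1[ (EFin \o w) ->
  (forall x, 0 < x < 1 -> u x = C + \int[mu]_(y in `]0, x]) w y) ->
  weak_derivative u w.
Proof.
move=> iw uE; split=> // phi tphi.
have [ip <-] := primitive_by_parts iw tphi.
have [dphi cphi [K [_ K01] Kphi]] := tphi.
have iphi : mu.-integrable `[0, 1] (EFin \o derive1 phi).
  apply: continuous_compact_integrable; first exact: segment_compact.
  exact: continuous_subspaceT.
have iphi' : mu.-integrable `]0, 1[ (EFin \o derive1 phi).
  apply: integrableS iphi => //.
  by move=> x /=; rewrite !in_itv/= => /andP[/ltW -> /ltW].
have iphi'' : mu.-integrable `]0, 1] (EFin \o derive1 phi).
  apply: integrableS iphi => //.
  by move=> x /=; rewrite !in_itv/= => /andP[/ltW ->].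
transitivity (\int[mu]_(x in `]0, 1[)
  (C * derive1 phi x + (\int[mu]_(y in `]0, x]) w y) * derive1 phi x)).
  by apply: eq_Rintegral => x; rewrite inE/= in_itv/= => x01; rewrite uE// mulrDl.
have iC : mu.-integrable `]0, 1[ (EFin \o (fun x => C * derive1 phi x)).
  exact: (@integrableZl _ _ _ mu `]0, 1[%classic _ C (EFin \o derive1 phi)).
rewrite RintegralD// RintegralZl// Rintegral_itv_bndo_bndc// Rintegral_itv_obnd_cbnd//.
rewrite integral_derive1_itvcc//.
have -> : phi 1 = 0 by apply: Kphi => /K01; rewrite /= in_itv/= ltxx andbF.
have -> : phi 0 = 0 by apply: Kphi => /K01; rewrite /= in_itv/= ltxx.
by rewrite subrr mulr0 add0r.
Qed.

(** The chosen [wderiv u] is some weak derivative of [u] because one exists, and the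
difference of two weak derivatives is orthogonal to all test functions. *)
Lemma wderiv_ae (u w : R -> R) : weak_derivative u w ->
  {ae mu, forall x, 0 < x < 1 -> wderiv u x = w x}.
Proof.
move=> uw; have [iw Hw] := uw.
have [iw' Hw'] : weak_derivative u (wderiv u).
  by rewrite /wderiv; case: xgetP => [v -> //|/(_ w)].
have id : mu.-integrable `]0, 1[ (EFin \o (fun x => wderiv u x - w x)).
  exact: integrable_sub.
apply: ae_mono (test_orthogonal_ae_eq0 id _) _; last first.
  by move=> x H /H /eqP; rewrite subr_eq0 => /eqP.
move=> phi tphi; have cphi := test_function_continuous tphi.
under eq_Rintegral do rewrite mulrBl.
rewrite RintegralB//; [|exact: integrable_mul_continuous..].
by apply/eqP; rewrite subr_eq0 -eqr_opp -Hw -?Hw'.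
Qed.

End weak_derivative_existence.

(** * Waves along characteristics *)

Section wave_characteristics_section.
Context {R : realType}.
Local Notation mu := (@lebesgue_measure R).
Implicit Types (c x a b t T p : R) (D : set R).

Lemma two_div_sqrt2 : 2 / Num.sqrt 2 = Num.sqrt 2 :> R.
Proof.
have s0 : Num.sqrt 2 != 0 :> R by rewrite gt_eqF// sqrtr_gt0.
by apply: (mulIf s0); rewrite divfK// -expr2 sqr_sqrtr.
Qed.

Lemma oriented_int_shift (f : R -> R) t x : 0 <= t -> 0 <= x ->
  (forall T, 0 < T -> mu.-integrable `]0, T[ (EFin \o f)) ->
  oriented_int 0 (t + x) f =
  \int[mu]_(y in `]0, t]) f y + \int[mu]_(y in `]0, x]) f (t + y).
Proof.
move=> t0 x0 intf; rewrite /oriented_int addr_ge0//.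
have intf' T : mu.-integrable `]0, T] (EFin \o f).
  have [T0|T0] := leP 0 T.
    have := intf (T + 1) (ltr_wpDl T0 ltr01).
    apply: integrableS => // y /=; rewrite !in_itv/= => /andP[-> yT].
    by rewrite (le_lt_trans yT)// ltrDl.
  by rewrite set_itv_ge -?leNgt ?bnd_simp ?ltW//; exact: integrable_set0.
rewrite -Rintegral_itv_obnd_cbnd//.
have := @Rintegral_itvB R f (BRight 0) (BRight (t + x)) t (intf' _).
rewrite !bnd_simp => /(_ t0); rewrite lerDl => /(_ x0) /eqP.
rewrite subr_eq => /eqP ->; rewrite [RHS]addrC; congr (_ + _).
rewrite (@lebesgue_preserving_Rintegral R (fun y => y + t))//.
- rewrite (_ : _ @^-1` _ = `]0, x]%classic).
    by apply: eq_Rintegral => y _; rewrite addrC.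
  by apply/seteqP; split => y /=; rewrite !in_itv/= ltrDr (addrC y) lerD2l.
- exact: lebesgue_preserving_shift.
- apply/measurable_EFinP; apply: (measurable_int mu); apply: integrableS (intf' (t + x)) => //.
  by move=> y /=; rewrite !in_itv/= => /andP[ty ->]; rewrite (le_lt_trans t0 ty).
Qed.

Lemma oriented_int_reflect (g : R -> R) t x : 0 <= t -> 0 <= x < 1 ->
  (forall T, -1 < T -> mu.-integrable `]-1, T[ (EFin \o g)) ->
  oriented_int 0 (t - x) g =
  \int[mu]_(y in `]0, t]) g y - \int[mu]_(y in `]0, x]) g (t - y).
Proof.
move=> t0 /andP[x0 x1] intg.
have intg' T : mu.-integrable `[- x, T] (EFin \o g).
  have [T0|T0] := leP (- x) T.
    have T1 : -1 < T + 1 by lra.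
    apply: integrableS (intg _ T1) => // y /=; rewrite !in_itv/= => /andP[xy yT].
    by apply/andP; split; lra.
  by rewrite set_itv_ge -?ltNge ?bnd_simp//; exact: integrable_set0.
have intgo (b : bool) (c T : R) : - x <= c ->
    mu.-integrable [set` Interval (BSide b c) (BRight T)] (EFin \o g).
  move=> xc; apply: integrableS (intg' T) => //.
  move=> y /=; rewrite !in_itv/=; case: b => /= /andP[cy ->]; rewrite andbT.
    exact: le_trans cy.
  exact: le_trans (ltW cy).
have refl : \int[mu]_(y in `]t - x, t]) g y = \int[mu]_(y in `]0, x]) g (t - y).
  have pr := @lebesgue_preserving_reflect R t.
  have igr : mu.-integrable `]t - x, t] (EFin \o g) by apply: intgo; lra.
  rewrite (@lebesgue_preserving_Rintegral R (fun y => t - y) _ _ pr)//; last first.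
    by apply/measurable_EFinP; exact: (measurable_int mu).
  have pE : (fun y => t - y) @^-1` `]t - x, t]%classic = `[0, x[%classic.
    apply/seteqP; split => y /=; rewrite !in_itv/= => /andP[? ?]; apply/andP; split; lra.
  have := lebesgue_preserving_integrable pr (measurable_itv _) igr; rewrite pE => igr'.
  rewrite Rintegral_itv_bndo_bndc//; apply/esym/Rintegral_itv_obnd_cbnd.
  have igr2 : mu.-integrable `[t - x, t] (EFin \o g) by apply: intgo; lra.
  have := lebesgue_preserving_integrable pr (measurable_itv _) igr2.
  apply: integrableS => //; first exact: lebesgue_preserving_preimage pr (measurable_itv _).
  by move=> y /=; rewrite !in_itv/= => /andP[? ?]; apply/andP; split; lra.
rewrite -refl /oriented_int; case: ifPn => tx.
  rewrite -Rintegral_itv_obnd_cbnd; last by apply: intgo; lra.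
  have := @Rintegral_itvB R g (BRight 0) (BRight t) (t - x).
  rewrite !bnd_simp => /(_ _ tx) <-; first ring.
    by apply: intgo; lra.
  lra.
have {}tx : t - x < 0 by rewrite ltNge.
have := @Rintegral_itvB R g (BRight (t - x)) (BRight t) 0.
rewrite !bnd_simp => <-//; [| by apply: intgo; lra|lra].
rewrite -Rintegral_itv_obnd_cbnd; last by apply: intgo; lra.
ring.
Qed.

(** The position of a wave at time [t] is the primitive of its slope [z_x], up to
the constant that is its value at [x = 0]. *)
Lemma wave_primitive (f g : R -> R) (t x : R) : 0 <= t -> 0 < x < 1 ->
  (forall T, 0 < T -> mu.-integrable `]0, T[ (EFin \o f)) ->
  (forall T, -1 < T -> mu.-integrable `]-1, T[ (EFin \o g)) ->
  mu.-integrable `]0, 1[ (EFin \o z_x f g t) /\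
  (Num.sqrt 2)^-1 * oriented_int 0 (t + x) f + (Num.sqrt 2)^-1 * oriented_int 0 (t - x) g =
  (Num.sqrt 2)^-1 * (\int[mu]_(y in `]0, t]) f y + \int[mu]_(y in `]0, t]) g y)
  + \int[mu]_(y in `]0, x]) z_x f g t y.
Proof.
move=> t0 /andP[x0 x1] intf intg.
have i1 : mu.-integrable `]0, 1[ (EFin \o (fun y => f (t + y))).
  have t1 : 0 < t + 1 by lra.
  have := lebesgue_preserving_integrable (lebesgue_preserving_shift t)
    (measurable_itv _) (intf _ t1).
  rewrite (_ : (EFin \o f) \o _ = EFin \o (fun y => f (t + y))); last first.
    by apply/funext => y /=; rewrite addrC.
  apply: integrableS => //.
    exact: lebesgue_preserving_preimage (lebesgue_preserving_shift t) (measurable_itv _).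
  by move=> y /=; rewrite !in_itv/= => /andP[? ?]; apply/andP; split; lra.
have i2 : mu.-integrable `]0, 1[ (EFin \o (fun y => g (t - y))).
  have t1 : -1 < t + 1 by lra.
  have := lebesgue_preserving_integrable (lebesgue_preserving_reflect t)
    (measurable_itv _) (intg _ t1).
  apply: integrableS => //.
    exact: lebesgue_preserving_preimage (lebesgue_preserving_reflect t) (measurable_itv _).
  by move=> y /=; rewrite !in_itv/= => /andP[? ?]; apply/andP; split; lra.
have sub D : measurable D -> D `<=` `]0, 1[ ->
    mu.-integrable D (EFin \o (fun y => f (t + y) - g (t - y))).
  move=> mD D01.
  suff : mu.-integrable `]0, 1[ (EFin \o (fun y => f (t + y) - g (t - y))).
    exact: integrableS.
  exact: (integrable_sub (measurable_itv _) i1 i2).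
have x01 : `]0, x] `<=` (`]0, 1[%classic : set R).
  by move=> y /=; rewrite !in_itv/= => /andP[-> /le_lt_trans]; exact.
have zxE : z_x f g t = fun y => (Num.sqrt 2)^-1 * (f (t + y) - g (t - y)).
  by apply/funext => y; rewrite /z_x mulrC.
split.
  rewrite zxE; apply: (@integrableZl _ _ _ mu `]0, 1[%classic _ _
    (EFin \o (fun y => f (t + y) - g (t - y)))) => //.
  exact: sub.
rewrite oriented_int_shift// ?oriented_int_reflect// ?ltW// ?x0//.
rewrite zxE RintegralZl//; last exact: sub.
rewrite RintegralB//.
- ring.
- by apply: integrableS i1.
- by apply: integrableS i2.
Qed.

Section solution.
Context (z : R -> R -> R) (f g : R -> R).
Hypothesis zE : forall t x : R, 0 <= t -> 0 <= x <= 1 ->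
        z t x = (Num.sqrt 2)^-1 * oriented_int 0 (t + x) f +
                (Num.sqrt 2)^-1 * oriented_int 0 (t - x) g.
Hypothesis intf : forall T, 0 < T -> mu.-integrable `]0, T[ (EFin \o f).
Hypothesis intg : forall T, -1 < T -> mu.-integrable `]-1, T[ (EFin \o g).

Lemma wave_weak_derivative t : 0 <= t -> weak_derivative (z t) (z_x f g t).
Proof.
move=> t0; apply: weak_derivative_primitive.
  have h : 0 < (2^-1 : R) < 1 by apply/andP; split; lra.
  by have [] := wave_primitive t0 h intf intg.
move=> x x01; rewrite zE//; last by case/andP: x01 => /ltW -> /ltW.
by have [_ ->] := wave_primitive t0 x01 intf intg.
Qed.

(** The constant of [wave_primitive] is the integral of [f + g] over [[0, t]]. *)
Lemma wave_reflection : {ae mu, forall t, 0 <= t -> z t 0 = 0} ->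
  {ae mu, forall t, 0 < t -> f t = - g t}.
Proof.
move=> Hz.
suff H (n : nat) : {ae mu, forall t, 0 < t < n.+1%:R -> f t = - g t}.
  apply: (ae_mono (ae_foralln H)) => t Ht t0; apply: (Ht (Num.truncn t)).
  by rewrite t0 truncnS_gt.
have n0 : 0 < n.+1%:R :> R by [].
have n1 : -1 < n.+1%:R :> R by lra.
have ig : mu.-integrable `]0, n.+1%:R[ (EFin \o g).
  apply: integrableS (intg n1) => // y /=; rewrite !in_itv/= => /andP[? ->].
  by rewrite andbT; lra.
have ifg : mu.-integrable `]0, n.+1%:R[ (EFin \o (fun x => f x + g x)).
  exact: (integrable_add (measurable_itv _) (intf n0) ig).
have : {ae mu, forall t, 0 < t < n.+1%:R -> f t + g t = 0}.
  apply: primitive_eq0_ae => //.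
  apply: (ae_mono Hz) => t zt /andP[t0 tn].
  have s : `]0, t] `<=` (`]0, n.+1%:R[%classic : set R).
    by move=> y /=; rewrite !in_itv/= => /andP[-> /le_lt_trans ->].
  rewrite RintegralD//; [|exact: integrableS (intf n0)|exact: integrableS ig].
  have := zt (ltW t0); rewrite zE ?lexx ?ltW// addr0 subr0 /oriented_int (ltW t0).
  rewrite -!Rintegral_itv_obnd_cbnd; [|exact: integrableS ig|exact: integrableS (intf n0)].
  rewrite -mulrDr => /eqP; rewrite mulf_eq0 invr_eq0 sqrtr_eq0 => /orP[|/eqP//].
  by rewrite leNgt ltr0n.
by move=> /ae_mono; apply => t H /H /eqP; rewrite addr_eq0 => /eqP.
Qed.

(** Each of the two combinations of slope and velocity in the norm of [X_p] sees
only one of the two travelling components. *)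
Lemma wave_characteristics t : 0 <= t ->
  {ae mu, forall x, 0 < x < 1 ->
    wderiv (z t) x + z_t f g t x = Num.sqrt 2 * f (t + x) /\
    wderiv (z t) x - z_t f g t x = - (Num.sqrt 2 * g (t - x))}.
Proof.
move=> t0; apply: (ae_mono (wderiv_ae (wave_weak_derivative t0))).
move=> x H x01; rewrite H// /z_t /z_x.
by split; rewrite -[in RHS]two_div_sqrt2; ring.
Qed.

Lemma measurable_wave_f t : 0 <= t ->
  measurable_fun (`]0, 1[%classic : set R) (fun x => f (t + x)).
Proof.
move=> t0; have t1 : 0 < t + 1 by lra.
have mf : measurable_fun (`]0, t + 1[%classic : set R) f.
  by apply/measurable_EFinP; exact: (measurable_int mu (intf t1)).
have := lebesgue_preserving_measurable_fun (lebesgue_preserving_shift t) (measurable_itv _) mf.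
have -> : f \o (fun x => x + t) = fun x => f (t + x) by apply/funext => x /=; rewrite addrC.
apply: measurable_funS => //.
  exact: lebesgue_preserving_preimage (lebesgue_preserving_shift t) (measurable_itv _).
by move=> y /=; rewrite !in_itv/= => /andP[? ?]; apply/andP; split; lra.
Qed.

Lemma measurable_wave_g t : 0 <= t ->
  measurable_fun (`]0, 1[%classic : set R) (fun x => g (t - x)).
Proof.
move=> t0; have t1 : -1 < t + 1 by lra.
have mg : measurable_fun (`]-1, t + 1[%classic : set R) g.
  by apply/measurable_EFinP; exact: (measurable_int mu (intg t1)).
have := lebesgue_preserving_measurable_fun (lebesgue_preserving_reflect t) (measurable_itv _) mg.
apply: measurable_funS => //.
  exact: lebesgue_preserving_preimage (lebesgue_preserving_reflect t) (measurable_itv _).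
by move=> y /=; rewrite !in_itv/= => /andP[? ?]; apply/andP; split; lra.
Qed.

(** The two travelling components cover [[t, t + 1]] and [[t - 1, t]]; the factor
[2^(-p/2)] of the norm cancels the factor [sqrt 2] of each. *)
Lemma wave_energy_p p t : 1 <= p -> 0 <= t ->
  {ae mu, forall t, 0 < t -> f t = - g t} ->
  energy p%:E z f g t =
  ((\int[mu]_(x in `](t - 1)%R, (t + 1)%R[) (`|g x| `^ p)%R%:E) `^ p^-1%R)%E.
Proof.
move=> p1 t0 fg; rewrite /energy /X_norm; congr (_ `^ _)%E.
have mF := measurable_wave_f t0; have mG := measurable_wave_g t0.
have mw : measurable_fun (`]0, 1[%classic : set R) (wderiv (z t)).
  have [iw' _] : weak_derivative (z t) (wderiv (z t)).
    rewrite /wderiv; case: xgetP => [v _ //|/(_ (z_x f g t))].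
    by have := wave_weak_derivative t0.
  by apply/measurable_EFinP; exact: (measurable_int mu iw').
have mzt : measurable_fun (`]0, 1[%classic : set R) (z_t f g t).
  rewrite (_ : z_t f g t = fun x => (Num.sqrt 2)^-1 * (f (t + x) + g (t - x))); last first.
    by apply/funext => x; rewrite /z_t mulrC.
  by apply: measurable_funM => //; exact: measurable_funD.
transitivity ((2 `^ (- (p / 2)))%R%:E * \int[mu]_(x in `]0%R, 1%R[)
  ((Num.sqrt 2 `^ p)%R%:E * ((`|f (t + x)| `^ p)%R%:E + (`|g (t - x)| `^ p)%R%:E)))%E.
  congr (_ * _)%E; apply: ge0_ae_eq_integral => //.
  - apply/measurable_EFinP; apply: measurable_funD; apply: measurable_norm_powR.
      exact: measurable_funD.
    exact: measurable_funB.
  - by apply: measurable_funeM; apply: emeasurable_funD; exact: measurable_norm_powR_EFin.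
  - by move=> x _; rewrite -EFinD -EFinM lee_fin mulr_ge0// ?addr_ge0// powR_ge0.
  - apply: (ae_mono (wave_characteristics t0)) => x H; rewrite /= in_itv/= => x01.
    have [-> ->] := H x01; rewrite normrN !normrM (ger0_norm (sqrtr_ge0 _)).
    by rewrite !powRM ?sqrtr_ge0// -EFinD -EFinM mulrDr.
rewrite ge0_integralZl//; last 2 first.
- by apply: emeasurable_funD; exact: measurable_norm_powR_EFin.
- by move=> x _; rewrite -EFinD lee_fin addr_ge0// powR_ge0.
rewrite muleA -EFinM -powR12_sqrt// -powRrM powRN mulrC (mulrC p) mulfV ?gt_eqF ?powR_gt0//.
rewrite mul1e ge0_integralD//; [|exact: measurable_norm_powR_EFin..].
have t1 : 0 < t + 1 by lra.
have t1' : -1 < t + 1 by lra.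
have mg : measurable_fun (`]t - 1, t + 1[%classic : set R) g.
  apply/measurable_EFinP; apply: (measurable_int mu); apply: integrableS (intg t1') => //.
  by move=> y /=; rewrite !in_itv/= => /andP[? ?]; apply/andP; split; lra.
have mf : measurable_fun (`]t, t + 1[%classic : set R) f.
  apply/measurable_EFinP; apply: (measurable_int mu); apply: integrableS (intf t1) => //.
  by move=> y /=; rewrite !in_itv/= => /andP[? ?]; apply/andP; split; lra.
have mg1 : measurable_fun (`]t, t + 1[%classic : set R) g.
  by apply: measurable_funS mg => // y /=; rewrite !in_itv/= => /andP[? ?]; apply/andP; split; lra.
have mg2 : measurable_fun (`]t - 1, t[%classic : set R) g.
  by apply: measurable_funS mg => // y /=; rewrite !in_itv/= => /andP[? ?]; apply/andP; split; lra.
have n0 (h : R -> R) x : (0 <= (`|h x| `^ p)%:E)%E by rewrite lee_fin powR_ge0.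
have Ef : (\int[mu]_(x in `]0%R, 1%R[) (`|f (t + x)| `^ p)%R%:E =
           \int[mu]_(x in `]t, (t + 1)%R[) (`|g x| `^ p)%R%:E)%E.
  transitivity (\int[mu]_(x in `]t, (t + 1)%R[) (`|f x| `^ p)%R%:E)%E.
    have := lebesgue_preserving_ge0_integral (lebesgue_preserving_shift t)
      (measurable_itv `]t, t + 1[) (measurable_norm_powR_EFin p mf) (fun x _ => n0 f x).
    have -> : (fun x => x + t) @^-1` `]t, t + 1[%classic = `]0, 1[%classic.
      by apply/seteqP; split => y /=; rewrite !in_itv/= => /andP[? ?]; apply/andP; split; lra.
    by move=> ->; apply: eq_integral => y _; rewrite addrC.
  apply: ge0_ae_eq_integral => //; [exact: measurable_norm_powR_EFin|exact: measurable_norm_powR_EFin|].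
  apply: (ae_mono fg) => x H; rewrite /= in_itv/= => /andP[tx _].
  by rewrite H ?normrN// (le_lt_trans t0).
have Eg : (\int[mu]_(x in `]0%R, 1%R[) (`|g (t - x)| `^ p)%R%:E =
           \int[mu]_(x in `](t - 1)%R, t[) (`|g x| `^ p)%R%:E)%E.
  have := lebesgue_preserving_ge0_integral (lebesgue_preserving_reflect t)
    (measurable_itv `]t - 1, t[) (measurable_norm_powR_EFin p mg2) (fun x _ => n0 g x).
  have -> : (fun x => t - x) @^-1` `]t - 1, t[%classic = `]0, 1[%classic.
    by apply/seteqP; split => y /=; rewrite !in_itv/= => /andP[? ?]; apply/andP; split; lra.
  by move=> ->.
have tt : t - 1 <= t by lra.
have tt' : t <= t + 1 by lra.
have Eg' := ge0_integral_itv_split tt tt' (measurable_norm_powR_EFin p mg) (n0 g).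
by rewrite Eg' Ef Eg; exact: addeC.
Qed.

End solution.

End wave_characteristics_section.

(** * Trajectories of the boundary relation *)

Section trajectories.
Context {R : realType}.
Local Notation mu := (@lebesgue_measure R).
Implicit Types (c x a b t T p : R) (D : set R).

(** For [xi = ((u - v) / sqrt 2, (u + v) / sqrt 2)] the rotation sends [xi] to
[(u, v)], so the consecutive terms form a point of the rotated [Sigma]. *)
Definition trajectory (Sigma : set (R * R)) (x : nat -> R) : Prop :=
  forall n, Sigma ((x n - x n.+1) / Num.sqrt 2, (x n + x n.+1) / Num.sqrt 2).

Section damped.
Variable (Sigma : set (R * R)).
Hypothesis dissip : forall x y : R, Sigma (x, y) -> 0 <= x * y.

(** The product of the coordinates of the point of [Sigma] is
[(x ^+ 2 - y ^+ 2) / 2]. *)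
Lemma dissipative_step (x y : R) :
  Sigma ((x - y) / Num.sqrt 2, (x + y) / Num.sqrt 2) -> `|y| <= `|x|.
Proof.
move=> /dissip; rewrite mulrACA -invfM -expr2 sqr_sqrtr// => H.
rewrite -ler_sqr ?nnegrE// !real_normK ?num_real//.
by rewrite -subr_ge0 subr_sqr; lra.
Qed.

Lemma trajectory_le (x : nat -> R) m n : trajectory Sigma x -> (m <= n)%N -> `|x n| <= `|x m|.
Proof.
move=> tx /subnK <-; elim: (n - m)%N => [|k IH]//=.
exact: le_trans (dissipative_step (tx _)) IH.
Qed.
End damped.

Section steps.
Variable x : nat -> R.

(** The index [n] such that [s] lies in [[2 n - 1, 2 n + 1[], for [s >= -1]. *)
Definition step_index (s : R) : nat := Num.truncn ((s + 1) / 2).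
Definition steps (s : R) : R := x (step_index s).

Lemma measurable_steps : measurable_fun setT steps.
Proof.
move=> _ Y mY; rewrite setTI.
have -> : steps @^-1` Y = \bigcup_(n in [set n | Y (x n)]) [set s | step_index s = n].
  by apply/seteqP; split => [s /= Ys|s [n Yn sn]]; [exists (step_index s)|rewrite /= /steps sn].
apply: bigcup_measurable => n _.
have mle k : measurable [set s | (step_index s <= k)%N].
  rewrite (_ : mkset _ = `]-oo, (k.+1%:R * 2 - 1)[%classic); first exact: measurable_itv.
  apply/seteqP; split => s /=; rewrite in_itv/= truncn_le_nat; lra.
case: n => [|n].
  rewrite (_ : mkset _ = [set s | (step_index s <= 0)%N]); first exact: mle.
  by apply/seteqP; split => s /=; [move=> ->|rewrite leqn0 => /eqP].
rewrite (_ : mkset _ = [set s | (step_index s <= n.+1)%N] `\` [set s | (step_index s <= n)%N]).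
  exact: measurableD.
apply/seteqP; split => s /=; first by move=> ->; rewrite leqnn ltnn.
by move=> [h1 /negP]; rewrite -ltnNge => h2; apply/eqP; rewrite eqn_leq h1 h2.
Qed.

Lemma step_index_def (n : nat) s : n%:R * 2 - 1 <= s < n%:R * 2 + 1 -> step_index s = n.
Proof.
move=> /andP[h1 h2]; apply: truncn_def; rewrite -[n.+1%:R]natr1.
by apply/andP; split; lra.
Qed.

Lemma step_index_succ s : 0 <= s -> step_index (s + 1) = (step_index (s - 1)).+1.
Proof.
move=> s0; apply: step_index_def; rewrite /step_index subrK.
have s2 : 0 <= s / 2 by rewrite divr_ge0.
have := truncn_itv s2; rewrite -[X in _ < X]natr1 => /andP[h1 h2].
rewrite -[_.+1%:R]natr1.
by apply/andP; split; lra.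
Qed.

Hypothesis x_bd : forall n, `|x n| <= `|x 0%N|.

Lemma steps_integrable a b : mu.-integrable `]a, b[ (EFin \o steps).
Proof.
apply: measurable_bounded_integrable => //.
- exact: lebesgue_itvoo_lty.
- by apply: measurable_funTS; exact: measurable_steps.
- exists `|x 0%N|; split; first exact: num_real.
  by move=> M xM s _ /=; apply: le_trans (ltW xM); exact: x_bd.
Qed.

(** The wave whose component [g] takes the value [x n] during the [n]-th period; its
position at time [0] is linear and its velocity vanishes. *)
Definition steps_wave (t y : R) : R :=
  (Num.sqrt 2)^-1 * oriented_int 0 (t + y) (fun s => - steps s) +
  (Num.sqrt 2)^-1 * oriented_int 0 (t - y) steps.

Lemma stepsN_integrable a b : mu.-integrable `]a, b[ (EFin \o (fun s => - steps s)).
Proof.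
have -> : EFin \o (fun s => - steps s) = (\- (EFin \o steps))%E by [].
exact/integrableN/steps_integrable.
Qed.

(** At the times [2 n] both components are constant on the whole segment. *)
Lemma steps_energy (n : nat) :
  energy +oo%E steps_wave (fun s => - steps s) steps (n%:R * 2) = `|x n|%:E.
Proof.
have t0 : 0 <= n%:R * 2 :> R by [].
have ch := wave_characteristics (z := steps_wave) (fun t x _ _ => erefl)
  (fun T _ => stepsN_integrable 0 T) (fun T _ => steps_integrable (-1) T) t0.
have s20 : 0 <= Num.sqrt 2 :> R by [].
rewrite /energy /X_norm.
rewrite (@Lnorm_oo_cst R _ (- (Num.sqrt 2 * x n))); last first.
  apply: (ae_mono ch) => y H y01; have [-> _] := H y01.
  by rewrite /steps (@step_index_def n) ?mulrN//; case/andP: y01 => *; apply/andP; split; lra.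
rewrite (@Lnorm_oo_cst R _ (- (Num.sqrt 2 * x n))); last first.
  apply: (ae_mono ch) => y H y01; have [_ ->] := H y01.
  by rewrite /steps (@step_index_def n)//; case/andP: y01 => *; apply/andP; split; lra.
rewrite maxxx normrN normrM (ger0_norm s20) -EFinM mulrA mulVf ?mul1r//.
Qed.

Lemma oriented_intN (h : R -> R) t : (forall b c, mu.-integrable `]b, c[ (EFin \o h)) ->
  oriented_int 0 t (fun s => - h s) = - oriented_int 0 t h.
Proof.
move=> ih.
have icc b c : mu.-integrable `[b, c] (EFin \o h).
  apply: integrableS (ih (b - 1) (c + 1)) => // y /=; rewrite !in_itv/= => /andP[? ?].
  by apply/andP; split; lra.
have N b c : \int[mu]_(s in `[b, c]) (- h s) = - \int[mu]_(s in `[b, c]) h s.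
  under eq_Rintegral do rewrite -mulN1r.
  by rewrite RintegralZl// mulN1r.
by rewrite /oriented_int; case: ifP => _; rewrite N.
Qed.

Lemma steps_wave0 y : 0 < y < 1 -> steps_wave 0 y = - (Num.sqrt 2 * x 0%N) * y.
Proof.
move=> y01; rewrite /steps_wave.
have [_ ->] := wave_primitive (lexx 0) y01
  (fun T _ => stepsN_integrable 0 T) (fun T _ => steps_integrable (-1) T).
rewrite set_itvoc0 !Rintegral_set0 addr0 mulr0 add0r.
transitivity (\int[mu]_(s in `]0, y]) (- (Num.sqrt 2 * x 0%N))).
  apply: eq_Rintegral => s; rewrite inE/= in_itv/= => /andP[s0 sy].
  have s1 : s < 1 by case/andP: y01 => _; exact: le_lt_trans.
  rewrite /z_x /steps !(@step_index_def 0%N); last 2 first.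
  - by apply/andP; split; lra.
  - by apply/andP; split; lra.
  by rewrite -[in RHS]two_div_sqrt2; ring.
have muy : mu `]0, y]%classic = y%:E.
  by rewrite lebesgue_measure_itv/= lte_fin; case/andP: y01 => -> _; rewrite -EFinB subr0.
by rewrite Rintegral_cst//; congr (_ * _); exact: (congr1 fine muy).
Qed.

Lemma steps_wave_solution (Sigma : set (R * R)) : trajectory Sigma x ->
  wave_solution_with Sigma +oo%E (steps_wave 0) (z_t (fun s => - steps s) steps 0)
    steps_wave (fun s => - steps s) steps.
Proof.
move=> tx.
have ms (D : set R) : measurable_fun D steps by apply: measurable_funTS; exact: measurable_steps.
have mN (D : set R) : measurable_fun D (fun s => - steps s) by exact: measurable_funN.
have bd s : `|steps s| <= `|x 0%N| by exact: x_bd.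
split.
- split=> T _.
    apply: (bounded_in_Loo (normr_ge0 (x 0%N)) (measurable_itv _) (mN _)) => s _.
    by rewrite normrN.
  exact: (bounded_in_Loo (normr_ge0 (x 0%N)) (measurable_itv _) (ms _)).
- by [].
- apply: aeW => t t0; split.
    rewrite /steps_wave addr0 subr0 oriented_intN; last exact: steps_integrable.
    by rewrite mulrN addNr.
  have := tx (step_index (t - 1)); rewrite -step_index_succ//.
  by congr (Sigma (_, _)); rewrite /z_t /z_x /steps; ring.
- exact: aeW.
Qed.

(** The initial position agrees with a linear function on the segment, so all the
requirements of the space reduce to boundedness. *)
Lemma steps_wave_initial : X_space +oo%E (steps_wave 0) (z_t (fun s => - steps s) steps 0).
Proof.
have ms (D : set R) : measurable_fun D steps by apply: measurable_funTS; exact: measurable_steps.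
have mf (D : set R) : measurable_fun D (fun s => steps (0 + s)).
  apply: measurable_funTS; apply: (measurableT_comp measurable_steps).
  exact: measurable_funD.
have mg (D : set R) : measurable_fun D (fun s => steps (0 - s)).
  apply: measurable_funTS; apply: (measurableT_comp measurable_steps).
  exact: measurable_funB.
have s0 : 0 <= (Num.sqrt 2)^-1 :> R by [].
have C0 : 0 <= (`|x 0%N| + `|x 0%N|) / Num.sqrt 2 by rewrite divr_ge0// addr_ge0.
split; last first.
  apply: bounded_in_Loo C0 _ _ _ => //.
    rewrite /z_t; apply: measurable_funM => //; apply: measurable_funD => //.
    exact: measurable_funN.
  move=> y _; rewrite /z_t normrM (ger0_norm s0) ler_wpM2r// (le_trans (ler_normD _ _))//.
  by rewrite normrN lerD// x_bd.
split.
- have C1 : 0 <= Num.sqrt 2 * `|x 0%N| by rewrite mulr_ge0.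
  have : in_Lp +oo%E `]0, 1[ (fun y => - (Num.sqrt 2 * x 0%N) * y).
    apply: (bounded_in_Loo C1 (measurable_itv _)).
      by apply: measurable_funTS; exact: mulrl_measurable.
    move=> y /=; rewrite in_itv/= => /andP[y0 y1].
    by rewrite normrM normrN normrM (ger0_norm (sqrtr_ge0 _)) ler_piMr// ger0_norm ltW.
  rewrite /in_Lp; set h1 := _ \_ _; set h2 := _ \_ _; suff -> : h1 = h2 by [].
  apply/funext => y; rewrite /h1 /h2 !patchE; case: ifPn => //.
  by rewrite inE/= in_itv/= => y01; rewrite steps_wave0.
- exists (z_x (fun s => - steps s) steps 0).
    exact: (wave_weak_derivative (z := steps_wave) (fun t x _ _ => erefl)
      (fun T _ => stepsN_integrable 0 T) (fun T _ => steps_integrable (-1) T)).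
  apply: bounded_in_Loo C0 _ _ _ => //.
    rewrite /z_x; apply: measurable_funM => //; apply: measurable_funB => //.
    exact: measurable_funN.
  move=> y _; rewrite /z_x normrM (ger0_norm s0) ler_wpM2r// (le_trans (ler_normB _ _))//.
  by rewrite normrN lerD// x_bd.
- exists (fun y => - (Num.sqrt 2 * x 0%N) * y); split.
  + by apply: continuous_subspaceT => y; exact: mulrl_continuous.
  + by apply: aeW => y /=; rewrite in_itv/=; exact: steps_wave0.
  + by rewrite mulr0.
Qed.

End steps.

(** The decay rate of waves in [X_oo] is a decay rate of trajectories. *)
Lemma UGAS_oo_trajectory (Sigma : set (R * R)) (beta : R -> R -> R) :
  (forall x y : R, Sigma (x, y) -> 0 <= x * y) ->
  UGAS_with_rate Sigma +oo%E beta ->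
  forall x : nat -> R, trajectory Sigma x ->
  forall n, `|x n| <= beta `|x 0%N| (n%:R * 2).
Proof.
move=> dis [_ ugas] x tx n.
have xb k : `|x k| <= `|x 0%N| by exact: trajectory_le dis _ _ _ tx _.
have t0 : 0 <= n%:R * 2 :> R by [].
have := ugas _ _ _ _ _ (steps_wave_initial xb) (steps_wave_solution xb tx) _ t0.
have := steps_energy xb 0; rewrite mul0r => ->.
by rewrite steps_energy//.
Qed.

(** The exceptional set is a countable union of translates of null sets, one for each
step of the trajectory. *)
Lemma wave_trajectories Sigma (f g : R -> R) :
  {ae mu, forall t, 0 < t -> f t = - g t} ->
  {ae mu, forall t, 0 <= t -> Sigma (z_t f g t 1, - z_x f g t 1)} ->
  {ae mu, forall s, -1 < s < 1 -> trajectory Sigma (fun n => g (s + n%:R * 2))}.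
Proof.
move=> fg bc.
have H (n : nat) : {ae mu, forall s, -1 < s < 1 ->
    Sigma ((g (s + n%:R * 2) - g (s + n.+1%:R * 2)) / Num.sqrt 2,
           (g (s + n%:R * 2) + g (s + n.+1%:R * 2)) / Num.sqrt 2)}.
  have fg1 := lebesgue_preserving_ae (lebesgue_preserving_shift (n.+1%:R * 2)) fg.
  have bc1 := lebesgue_preserving_ae (lebesgue_preserving_shift (n%:R * 2 + 1)) bc.
  apply: (ae_mono2 fg1 bc1) => s fs bs /andP[s0 s1].
  have n0 : 0 <= n%:R :> R by [].
  have nE : n.+1%:R = n%:R + 1 :> R by rewrite natr1.
  have /fs {}fs : 0 < s + n.+1%:R * 2 by lra.
  have /bs : 0 <= s + (n%:R * 2 + 1) by lra.
  have e1 : s + (n%:R * 2 + 1) + 1 = s + n.+1%:R * 2 by rewrite nE; ring.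
  have e2 : s + (n%:R * 2 + 1) - 1 = s + n%:R * 2 by ring.
  by rewrite /z_t /z_x e1 e2 fs; congr (Sigma (_, _)); ring.
by apply: (ae_mono (ae_foralln H)) => s Hs s1 n; exact: Hs.
Qed.

End trajectories.

(** * Decay of trajectories *)

Section trajectory_decay_section.
Context {R : realType}.
Implicit Types Sigma : set (R * R).

Section KL.
Variable beta : R -> R -> R.
Hypothesis kl : KL_function beta.

Lemma KL_ge0 (x t : R) : 0 <= x -> 0 <= t -> 0 <= beta x t.
Proof. by case: kl => _ + _ _; apply. Qed.

Lemma KL_le_l (x y t : R) : 0 <= x -> x <= y -> 0 <= t -> beta x t <= beta y t.
Proof.
move=> x0; rewrite le_eqVlt => /predU1P[->//|xy] t0.
by case: kl => _ _ /(_ t t0)[_ h] _; exact/ltW/h.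
Qed.

Lemma KL_le_r (x s t : R) : 0 < x -> 0 <= s -> s <= t -> beta x t <= beta x s.
Proof.
move=> x0 s0; rewrite le_eqVlt => /predU1P[->//|st].
by case: kl => _ _ _ /(_ x x0)[h _]; exact/ltW/h.
Qed.
End KL.

(** If the point [((x - y) / sqrt 2, (x + y) / sqrt 2)] lies in the sector, then
[`|x - y|] and [`|x + y|] are comparable up to the factor [c], so that [y] is
bounded away from both [x] and [- x]: in fact
[`|y| <= (1 - c) / (1 + c) * `|x|]. *)
Lemma sector_contraction Sigma (M a b : R) :
  (forall x y : R, Sigma (x, y) -> 0 <= x * y) -> 0 < a -> 0 < b ->
  (forall x y : R, Sigma (x, y) -> M < Num.sqrt (x ^+ 2 + y ^+ 2) ->
     a * `|x| <= `|y| <= b * `|x|) ->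
  exists c : R, 0 < c <= 1 /\ forall x y : R,
    Sigma ((x - y) / Num.sqrt 2, (x + y) / Num.sqrt 2) -> M < `|x| ->
    `|y| <= (1 - c) * `|x|.
Proof.
move=> dis a0 b0 sector.
(* [c] bounds from below the ratio of [`|x + y|] to [`|x - y|] and its inverse *)
exists (Num.min 1 (Num.min a b^-1)); set c := Num.min _ _.
have c0 : 0 < c by rewrite !lt_min ltr01 a0 invr_gt0.
have c1 : c <= 1 by rewrite ge_min lexx.
have ca : c <= a by rewrite !ge_min lexx orbT.
have cb : c <= b^-1 by rewrite !ge_min lexx !orbT.
split; first by rewrite c0 c1.
move=> x y Sxy Mx.
have yx := dissipative_step dis Sxy.
have s2 : 0 < Num.sqrt 2 :> R by rewrite sqrtr_gt0.
have norm2 : ((x - y) / Num.sqrt 2) ^+ 2 + ((x + y) / Num.sqrt 2) ^+ 2 = x ^+ 2 + y ^+ 2.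
  by rewrite !expr_div_n sqr_sqrtr//; field.
have := sector _ _ Sxy; rewrite norm2.
have -> : M < Num.sqrt (x ^+ 2 + y ^+ 2).
  rewrite (lt_le_trans Mx)// -sqrtr_sqr ler_wsqrtr// lerDl sqr_ge0.
  done.
move=> /(_ isT); rewrite !normrM !mulrA !ler_pM2r ?normr_gt0 ?invr_neq0 ?gt_eqF//.
move=> /andP[h1 h2].
have h1' : c * `|x - y| <= `|x + y| by apply: le_trans h1; rewrite ler_wpM2r.
have h2' : c * `|x + y| <= `|x - y|.
  rewrite (@le_trans _ _ (b^-1 * `|x + y|))// ?ler_wpM2r//.
  by rewrite ler_pdivrMl.
clear -c0 c1 h1' h2' yx; wlog x0 : x y yx h1' h2' / 0 <= x.
  move=> W; have [x0|/ltW x0] := leP 0 x; first exact: W.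
  rewrite -(normrN x) -(normrN y); apply: W; rewrite ?normrN ?oppr_ge0//.
    by rewrite -!opprD !normrN.
  by rewrite -!opprD !normrN.
move: yx h1' h2'; rewrite (ger0_norm x0) ler_norml => /andP[y1 y2].
rewrite (@ger0_norm _ (x - y)) ?(@ger0_norm _ (x + y)); [|lra|lra].
move=> h1 h2; rewrite ler_norml; apply/andP; split; nra.
Qed.

(** Above [M] the relation contracts.  If the trajectory is below [M] at some
step [j < k], the rate [beta M] acts on the remaining [n - j >= k] steps, and
the bound [beta M (2 k)] is turned into a multiple of [`|x 0|] when
[`|x 0| > M].  The two alternatives are not merged into a sum because they are
raised to the power [p] afterwards. *)
Lemma trajectory_decay Sigma (M c : R) (beta : R -> R -> R) (x : nat -> R) (k n : nat) :
  KL_function beta -> 0 < M -> c <= 1 ->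
  (forall x y : R, Sigma (x, y) -> 0 <= x * y) ->
  (forall x y : R, Sigma ((x - y) / Num.sqrt 2, (x + y) / Num.sqrt 2) ->
    M < `|x| -> `|y| <= (1 - c) * `|x|) ->
  (forall x : nat -> R, trajectory Sigma x ->
     forall n, `|x n| <= beta `|x 0%N| (n%:R * 2)) ->
  trajectory Sigma x -> (k.*2 <= n)%N ->
  `|x n| <= ((1 - c) ^+ k + beta M (k%:R * 2) / M) * `|x 0%N| \/
  `|x n| <= Num.min `|x 0%N| (beta M (k%:R * 2)).
Proof.
move=> kl M0 c1 dis contr bd tx kn.
have small y j m : trajectory Sigma y -> `|y 0%N| <= M -> (j <= m)%N ->
    `|y m| <= beta M (j%:R * 2).
  move=> ty yM jm; apply: le_trans (bd _ ty m) _.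
  apply: (@le_trans _ _ (beta M (m%:R * 2))).
    by apply: KL_le_l => //.
  apply: KL_le_r => //.
  by rewrite ler_wpM2r// ler_nat.
have B0 : 0 <= beta M (k%:R * 2) by apply: KL_ge0 => //; exact: ltW.
have [xM|Mx] := leP `|x 0%N| M.
  right; rewrite le_min (trajectory_le dis tx (leq0n _))/=.
  by apply: small => //; lia.
left; have [[j jk xj]|out] := pselect (exists2 j, (j < k)%N & `|x j| <= M).
  (* restart the trajectory at the step where it enters [-M, M] *)
  have tail : trajectory Sigma (fun i => x (j + i)%N) by move=> i; rewrite addnS; exact: tx.
  have := @small _ k (n - j)%N tail; rewrite addn0 => /(_ xj).
  rewrite subnKC; last lia.
  move=> /(_ ltac:(lia)) h.
  rewrite mulrDl ler_wpDl//; first by rewrite mulr_ge0// exprn_ge0// subr_ge0.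
  by rewrite (le_trans h)// mulrAC ler_pdivlMr// ler_wpM2l// ltW.
apply: (@le_trans _ _ ((1 - c) ^+ k * `|x 0%N|)); last first.
  by rewrite ler_wpM2r// lerDl divr_ge0// ltW.
apply: le_trans (trajectory_le dis tx (_ : (k <= n)%N)) _; first lia.
have : forall j, (j <= k)%N -> `|x j| <= (1 - c) ^+ j * `|x 0%N|.
  elim=> [_|j IH jk]; first by rewrite expr0 mul1r.
  have Mj : M < `|x j| by rewrite ltNge; apply/negP => xj; apply: out; exists j.
  apply: le_trans (contr _ _ (tx j) Mj) _.
  by rewrite exprS -mulrA ler_wpM2l ?subr_ge0// IH// ltnW.
exact.
Qed.

End trajectory_decay_section.

(** * Decay rates in the spaces with finite exponent *)

Section rate_functions.
Context {R : realType}.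
Implicit Types (c t : R).

Section rate.
Variables (beta : R -> R -> R) (M c : R).
Hypotheses (kl : KL_function beta) (M0 : 0 < M) (c0 : 0 < c).

(** At time [t] a wave has made at least [t / 2 - 1] full periods, and half of these,
rounded down and doubled, is at least [t / 2 - 2]. The truncation at [0] keeps
the argument of [beta] in its domain. *)
Definition delay (t : R) : R := Num.max 0 (t / 2 - 2).
Definition small_rate (t : R) : R := beta M (delay t).
Definition large_rate (t : R) : R := expR (c * (1 - t / 4)) + small_rate t / M.
(** The second term is neither strictly increasing in [x] nor strictly
decreasing in [t]; the first term, which comes from the data larger than [M],
makes the sum strictly monotone. *)
Definition Lp_rate (x t : R) : R := large_rate t * x + Num.min x (2 * small_rate t).

Lemma delay_ge0 t : 0 <= delay t. Proof. by rewrite /delay le_max lexx. Qed.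

Lemma delay_le (s t : R) : s <= t -> delay s <= delay t.
Proof. by move=> st; rewrite /delay le_max2 //; lra. Qed.

Lemma small_rate_ge0 t : 0 <= small_rate t.
Proof. by apply: KL_ge0 => //; [exact: ltW|exact: delay_ge0]. Qed.

Lemma large_rate_gt0 t : 0 < large_rate t.
Proof. by rewrite ltr_pwDl ?expR_gt0// divr_ge0 ?small_rate_ge0// ltW. Qed.

Lemma small_rate_le (s t : R) : s <= t -> small_rate t <= small_rate s.
Proof. by move=> st; apply: KL_le_r => //; [exact: delay_ge0|exact: delay_le]. Qed.

Lemma large_rate_lt (s t : R) : s < t -> large_rate t < large_rate s.
Proof.
move=> st; apply: ltr_leD; last by rewrite ler_pM2r ?invr_gt0// small_rate_le// ltW.
by rewrite ltr_expR ltr_pM2l//; lra.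
Qed.

(** [beta] is continuous only within the quadrant, which contains the values of
[delay]. *)
Lemma continuous_small_rate : continuous small_rate.
Proof.
case: kl => /subspace_continuousP cb _ _ _ t.
have := cb (M, delay t) (conj (ltW M0) (delay_ge0 t)).
rewrite /= => cbt.
apply: (@cvg_comp _ _ _ (fun t => (M, delay t)) (fun st : R * R => beta st.1 st.2) _ _ _ _ cbt).
have cd : (M, delay s) @[s --> t] --> (M, delay t).
  apply: (@cvg_pair _ _ _ _ (nbhs M) (nbhs (delay t))); first exact: cvg_cst.
  apply: (@continuous_max R R (cst 0) (fun t => t / 2 - 2) t); first exact: cvg_cst.
  by apply: cvgB; [exact: mulrr_continuous|exact: cvg_cst].
move=> U hU; have {}hU : nbhs t (fun s => 0 <= M /\ 0 <= delay s -> U (M, delay s)) := cd _ hU.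
suff : nbhs t (fun s => U (M, delay s)) by [].
by apply: filterS hU => s; apply; split; [exact: ltW|exact: delay_ge0].
Qed.

Lemma continuous_large_rate : continuous large_rate.
Proof.
move=> t; apply: cvgD.
  apply: (@continuous_comp _ _ _ (fun t => c * (1 - t / 4)) expR); last exact: continuous_expR.
  apply: cvgM; first exact: cvg_cst.
  by apply: cvgB; [exact: cvg_cst|exact: mulrr_continuous].
by apply: cvgM; [exact: continuous_small_rate|exact: cvg_cst].
Qed.

Lemma small_rate_cvg0 : small_rate t @[t --> +oo] --> 0.
Proof.
case: kl => _ _ _ /(_ M M0)[_ cb].
apply: (@cvg_comp _ _ _ delay (beta M) _ _ _ _ cb).
apply/cvgryPge => A; near=> t.
rewrite le_max; apply/orP; right.
suff : 2 * (A + 2) <= t by lra.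
by near: t; apply: nbhs_pinfty_ge; exact: num_real.
Unshelve. all: by end_near. Qed.

Lemma large_rate_cvg0 : large_rate t @[t --> +oo] --> 0.
Proof.
rewrite -[X in _ --> X]addr0; apply: cvgD; last first.
  by rewrite -[X in _ --> X](mul0r M^-1); apply: cvgM; [exact: small_rate_cvg0|exact: cvg_cst].
have -> : (fun t => expR (c * (1 - t / 4))) =
    (fun u => expR (- u)) \o (fun t => c * (t / 4 - 1)).
  by apply/funext => t /=; congr expR; ring.
apply: (@cvg_comp _ _ _ _ _ _ _ _ _ (@cvgr_expR R)).
apply/cvgryPge => A; near=> t.
rewrite -ler_pdivrMl//.
suff : 4 * (c^-1 * A + 1) <= t by lra.
by near: t; apply: nbhs_pinfty_ge; exact: num_real.
Unshelve. all: by end_near. Qed.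

Lemma KL_Lp_rate : KL_function Lp_rate.
Proof.
have min_ge0 (x t : R) : 0 <= x -> 0 <= Num.min x (2 * small_rate t).
  by move=> x0; rewrite le_min x0/= mulr_ge0// small_rate_ge0.
split.
- apply: continuous_subspaceT => -[x t] /=.
  rewrite /Lp_rate; apply: cvgD.
    apply: cvgM; last exact: cvg_fst.
    by apply: (@cvg_comp _ _ _ snd large_rate); [exact: cvg_snd|exact: continuous_large_rate].
  apply: (@continuous_min R _ fst (fun st : R * R => 2 * small_rate st.2) (x, t)).
    exact: cvg_fst.
  apply: cvgM; first exact: cvg_cst.
  by apply: (@cvg_comp _ _ _ snd small_rate); [exact: cvg_snd|exact: continuous_small_rate].
- move=> x t x0 t0; rewrite addr_ge0// ?min_ge0// mulr_ge0//.
  exact/ltW/large_rate_gt0.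
- move=> t t0; split.
    by rewrite /Lp_rate mulr0 add0r min_l// mulr_ge0// small_rate_ge0.
  move=> x y x0 xy; rewrite /Lp_rate ltr_leD ?ltr_pM2l ?large_rate_gt0//.
  by rewrite le_min2// ltW.
- move=> x x0; split.
    move=> s t s0 st; rewrite /Lp_rate ltr_leD ?ltr_pM2r ?large_rate_lt//.
    by rewrite le_min2// ler_pM2l// small_rate_le// ltW.
  rewrite /Lp_rate -[X in _ --> X]addr0; apply: cvgD.
    by rewrite -[X in _ --> X](mul0r x); apply: cvgM; [exact: large_rate_cvg0|exact: cvg_cst].
  apply: (@squeeze_cvgr _ _ _ _ (cst 0) (fun t => 2 * small_rate t)).
  + near=> t; apply/andP; split; first exact: min_ge0 (ltW x0).
    by rewrite ge_min lexx orbT.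
  + exact: cvg_cst.
  + by rewrite -[X in _ --> X](mulr0 2); apply: cvgM; [exact: cvg_cst|exact: small_rate_cvg0].
Unshelve. all: by end_near. Qed.

End rate.

(** The geometric decay is compared with an exponential through
[1 - c <= expR (- c)]. *)
Lemma decay_le_rates (beta : R -> R -> R) (M c t : R) (k : nat) :
  KL_function beta -> 0 < M -> 0 < c -> c <= 1 -> t / 4 - 1 <= k%:R ->
  (1 - c) ^+ k + beta M (k%:R * 2) / M <= large_rate beta M c t /\
  beta M (k%:R * 2) <= small_rate beta M t.
Proof.
move=> kl M0 c0 c1 kt.
have k0 : 0 <= k%:R :> R by [].
have tail : beta M (k%:R * 2) <= small_rate beta M t.
  apply: KL_le_r => //; first exact: delay_ge0.
  by rewrite /delay ge_max mulr_ge0//=; lra.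
split=> //; apply: lerD; last by rewrite ler_wpM2r// invr_ge0 ltW.
apply: (@le_trans _ _ (expR (- c) ^+ k)).
  rewrite lerXn2r ?nnegrE ?subr_ge0 ?expR_ge0//.
  exact: expR_ge1Dx.
rewrite -expRM_natl ler_expR.
suff : c * (t / 4 - 1) <= c * k%:R by lra.
by rewrite ler_pM2l.
Qed.

End rate_functions.

(** * Integration of the pointwise decay *)

Section decay_integration.
Context {R : realType}.
Local Notation mu := (@lebesgue_measure R).
Implicit Types (c a b s t T p : R) (D : set R) (Sigma : set (R * R)).

(** A window of length 2 meets at most two consecutive periods; the part in the second
one and the part in the first one are translates of complementary
subintervals of [[-1, 1]], on which [Psi] bounds both. *)
Lemma window_integral_le (h Psi : R -> \bar R) (m tau : R) : 0 <= tau <= 2 ->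
  measurable_fun (`]m - 1, m + 3[%classic : set R) h -> (forall x, 0 <= h x)%E ->
  measurable_fun (`]-1, 1[%classic : set R) Psi -> (forall x, 0 <= Psi x)%E ->
  {ae mu, forall s, -1 < s < 1 ->
    (h (s + m)%R <= Psi s)%E /\ (h (s + (m + 2))%R <= Psi s)%E} ->
  (\int[mu]_(s in `](m + tau - 1)%R, (m + tau + 1)%R[) h s <=
   \int[mu]_(s in `](-1)%R, 1%R[) Psi s)%E.
Proof.
move=> /andP[t0 t2] mh h0 mP P0 hP.
have shift a b d (H : forall s, a < s < b -> -1 < s < 1) :
    (forall s, d + a < s < d + b -> m - 1 < s < m + 3) ->
    {ae mu, forall s, -1 < s < 1 -> (h (s + d)%R <= Psi s)%E} ->
    (\int[mu]_(s in `](d + a)%R, (d + b)%R[) h s <= \int[mu]_(s in `]a, b[) Psi s)%E.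
  move=> H' hd.
  have mh' : measurable_fun (`]d + a, d + b[%classic : set R) h.
    apply: measurable_funS mh => // y /=; rewrite !in_itv/=; exact: H'.
  have pE : (fun s => s + d) @^-1` `]d + a, d + b[%classic = `]a, b[%classic.
    by apply/seteqP; split => y /=; rewrite !in_itv/= => /andP[? ?]; apply/andP; split; lra.
  have mhd := lebesgue_preserving_measurable_fun (lebesgue_preserving_shift d)
    (measurable_itv _) mh'.
  rewrite pE in mhd.
  have := lebesgue_preserving_ge0_integral (lebesgue_preserving_shift d)
    (measurable_itv _) mh' (fun x _ => h0 x).
  rewrite pE => ->.
  apply: ae_ge0_le_integral => //.
  - by apply: measurable_funS mP => // y /=; rewrite !in_itv/=; exact: H.
  - by apply: (ae_mono hd) => s hs; rewrite /= in_itv/= => /H.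
have le1 : m + tau - 1 <= m + 1 by lra.
have le2 : m + 1 <= m + tau + 1 by lra.
have le3 : -1 <= tau - 1 by lra.
have le4 : tau - 1 <= 1 by lra.
have mw : measurable_fun (`]m + tau - 1, m + tau + 1[%classic : set R) h.
  apply: measurable_funS mh => // y /=; rewrite !in_itv/= => /andP[? ?].
  by apply/andP; split; lra.
have -> := ge0_integral_itv_split le1 le2 mw h0.
have -> := ge0_integral_itv_split le3 le4 mP P0.
rewrite addeC; apply: leeD.
- have e1 : m + 1 = (m + 2) + -1 by ring.
  have e2 : m + tau + 1 = (m + 2) + (tau - 1) by ring.
  rewrite e1 e2; apply: shift.
  + by move=> s /andP[? ?]; apply/andP; split; lra.
  + by move=> s /andP[? ?]; apply/andP; split; lra.
  + by apply: (ae_mono hP) => s hs /hs[].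
- have e1 : m + tau - 1 = m + (tau - 1) by ring.
  rewrite e1; apply: shift.
  + by move=> s /andP[? ?]; apply/andP; split; lra.
  + by move=> s /andP[? ?]; apply/andP; split; lra.
  + by apply: (ae_mono hP) => s hs /hs[].
Qed.

Lemma powR_superadditive p (u v : R) : 1 <= p -> 0 <= u -> 0 <= v ->
  u `^ p + v `^ p <= (u + v) `^ p.
Proof.
move=> p1 u0 v0; have p0 : 0 < p by lra.
rewrite -(mulr_powRB1 (addr_ge0 u0 v0) p0) -(mulr_powRB1 u0 p0) -(mulr_powRB1 v0 p0) mulrDl.
have p1' : 0 <= p - 1 by lra.
have mono w : 0 <= w -> w <= u + v -> w `^ (p - 1) <= (u + v) `^ (p - 1).
  by move=> w0 wuv; apply: ge0_ler_powR => //; rewrite nnegrE// addr_ge0.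
by apply: lerD; apply: ler_wpM2l => //; apply: mono => //; lra.
Qed.

(** The [p]-th power is superadditive on nonnegative numbers, and the factor [2] is
absorbed by [2 <= 2 `^ p]. *)
Lemma Lp_rate_bound p (A B J : R) : 1 <= p -> 0 <= A -> 0 <= B -> 0 <= J ->
  (A `^ p * J + Num.min J (2 * B `^ p)) `^ p^-1 <= A * J `^ p^-1 + Num.min (J `^ p^-1) (2 * B).
Proof.
move=> p1 A0 B0 J0; have p0 : 0 < p by lra.
have pn0 : p != 0 by rewrite gt_eqF.
set E := J `^ p^-1; have E0 : 0 <= E by exact: powR_ge0.
have EJ : E `^ p = J by rewrite /E -powRrM mulVf ?gt_eqF// powRr1.
have m0 : 0 <= Num.min E (2 * B) by rewrite le_min E0/= mulr_ge0.
have mono (u v : R) r : 0 <= r -> 0 <= u -> u <= v -> u `^ r <= v `^ r.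
  by move=> r0 u0 uv; apply: ge0_ler_powR; rewrite ?nnegrE// (le_trans u0).
have AE : 0 <= A * E by rewrite mulr_ge0.
have rhs0 : 0 <= A * E + Num.min E (2 * B) by rewrite addr_ge0.
have rhsE : A * E + Num.min E (2 * B) = ((A * E + Num.min E (2 * B)) `^ p) `^ p^-1.
  by rewrite -powRrM mulfV// powRr1.
rewrite [leRHS]rhsE.
apply: mono; first by rewrite invr_ge0 ltW.
  by apply: addr_ge0; [rewrite mulr_ge0 ?powR_ge0|rewrite le_min J0/= mulr_ge0 ?powR_ge0].
apply: le_trans (powR_superadditive p1 AE m0).
rewrite powRM// EJ lerD2l.
have [EB|BE] := leP E (2 * B); first by rewrite EJ ge_min lexx.
rewrite powRM// ge_min; apply/orP; right; rewrite ler_wpM2r ?powR_ge0//.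
by apply: le1r_powR; rewrite ?ler1n.
Qed.

Lemma decay_powR p (A B u v : R) : 0 <= p -> 0 <= A -> 0 <= B ->
  `|v| <= A * `|u| \/ `|v| <= Num.min `|u| B ->
  `|v| `^ p <= A `^ p * `|u| `^ p + Num.min `|u| B `^ p.
Proof.
move=> p0 A0 B0 [h|h].
  apply: (@le_trans _ _ ((A * `|u|) `^ p)); last by rewrite powRM// lerDl powR_ge0.
  by apply: ge0_ler_powR => //; rewrite nnegrE// (le_trans _ h).
apply: (@le_trans _ _ (Num.min `|u| B `^ p)).
  by apply: ge0_ler_powR => //; rewrite nnegrE// (le_trans _ h).
by rewrite lerDr mulr_ge0// powR_ge0.
Qed.

(** The truncated term is bounded both by the [p]-th power of the norm and by the
length [2] of the interval times its maximum. *)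
Lemma majorant_integral_le p (A B J : R) (g : R -> R) : 0 <= p -> 0 <= A -> 0 <= B ->
  measurable_fun (`]-1, 1[%classic : set R) g ->
  mu.-integrable `]-1, 1[ (fun s => (`|g s| `^ p)%:E) ->
  J = \int[mu]_(s in `]-1, 1[) (`|g s| `^ p) ->
  (\int[mu]_(s in `](-1)%R, 1%R[) (A `^ p * `|g s| `^ p + Num.min `|g s| B `^ p)%R%:E <=
   (A `^ p * J + Num.min J (2 * B `^ p))%:E)%E.
Proof.
move=> p0 A0 B0 mg ig J_E.
have mgp : measurable_fun (`]-1, 1[%classic : set R) (fun s => (`|g s| `^ p)%:E).
  exact: measurable_norm_powR_EFin.
have mmin : measurable_fun (`]-1, 1[%classic : set R) (fun s => (Num.min `|g s| B `^ p)%:E).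
  apply/measurable_EFinP; apply: (measurableT_comp (measurable_powR _)).
  by apply: measurable_minr => //; exact: measurableT_comp.
have JE : (\int[mu]_(s in `](-1)%R, 1%R[) (`|g s| `^ p)%R%:E)%E = J%:E.
  by rewrite J_E fineK//; exact: integrable_fin_num.
under eq_integral do rewrite EFinD EFinM.
rewrite ge0_integralD//; last 3 first.
- by move=> s _; rewrite -EFinM lee_fin mulr_ge0// powR_ge0.
- exact: measurable_funeM.
- by move=> s _; rewrite lee_fin powR_ge0.
rewrite ge0_integralZl//; last by rewrite lee_fin powR_ge0.
rewrite JE EFinD EFinM leeD2lE// EFin_min le_min; apply/andP; split.
  rewrite -JE; apply: ge0_le_integral => //; first by move=> s _; rewrite lee_fin powR_ge0.
  move=> s _; rewrite lee_fin.
  apply: ge0_ler_powR => //; rewrite ?nnegrE ?le_min ?B0 ?andbT//.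
  by rewrite ge_min lexx.
apply: (@le_trans _ _ (\int[mu]_(s in `](-1)%R, 1%R[) (cst (B `^ p)%:E) s)%E).
  apply: ge0_le_integral => //.
  - by move=> s _; rewrite lee_fin powR_ge0.
  - move=> s _; rewrite lee_fin.
    apply: ge0_ler_powR => //; rewrite ?nnegrE ?le_min ?B0 ?andbT//.
    by rewrite ge_min lexx orbT.
have mu2 : mu `]-1, 1[%classic = 2%:E.
  by rewrite lebesgue_measure_itv/= lte_fin -EFinB ifT; [congr (_%:E); ring|lra].
rewrite integral_cst//.
by rewrite [leRHS]EFinM muleC lee_wpmul2r ?lee_fin ?powR_ge0// -mu2.
Qed.

End decay_integration.

Theorem theorem37 (R : realType) (Sigma : set (R * R)) (p M a b : R)
    (beta : R -> R -> R) :
  damping_set Sigma ->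
  1 <= p ->
  0 < M -> 0 < a -> 0 < b ->
  (forall x y : R, Sigma (x, y) -> M < Num.sqrt (x ^+ 2 + y ^+ 2) ->
     a * `|x| <= `|y| <= b * `|x|) ->
  UGAS_with_rate Sigma +oo%E beta ->
  UGAS Sigma p%:E.
Proof.
move=> [_ dis _] p1 M0 a0 b0 sector ugas.
have kl : KL_function beta by case: ugas.
have [c [/andP[c0 c1] contr]] := sector_contraction dis a0 b0 sector.
have bd := UGAS_oo_trajectory dis ugas.
exists (Lp_rate beta M c); split; first exact: KL_Lp_rate.
move=> z0 z1 z f g _ [[Lf Lg] zE zb _] t t0.
have p0 : 0 < p by lra.
have intf T : 0 < T -> (@lebesgue_measure R).-integrable `]0, T[ (EFin \o f).
  by move=> T0; exact: in_Lp_integrable p1 (Lf T T0).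
have intg T : -1 < T -> (@lebesgue_measure R).-integrable `]-1, T[ (EFin \o g).
  by move=> T0; exact: in_Lp_integrable p1 (Lg T T0).
have fg : {ae (@lebesgue_measure R), forall t, 0 < t -> f t = - g t}.
  by apply: (wave_reflection zE intf intg); apply: (ae_mono zb) => s H /H[].
have traj := wave_trajectories fg (ae_mono zb (fun s (H : 0 <= s -> _ /\ _) s0 => (H s0).2)).
have e0 := wave_energy_p zE intf intg p1 (lexx 0) fg.
have et := wave_energy_p zE intf intg p1 t0 fg.
rewrite et e0 sub0r add0r.
have ltN11 : -1 < 1 :> R by lra.
have iJ := in_Lp_integrable_powR p1 (measurable_itv _) (Lg 1 ltN11).
have mg T : -1 < T -> measurable_fun (`]-1, T[%classic : set R) g.
  by move=> T1; exact: in_Lp_measurable (measurable_itv _) (Lg T T1).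
pose J := \int[@lebesgue_measure R]_(s in `]-1, 1[) (`|g s| `^ p).
have JE : (\int[@lebesgue_measure R]_(s in `](-1)%R, 1%R[) (`|g s| `^ p)%R%:E)%E = J%:E.
  by rewrite fineK//; exact: integrable_fin_num.
rewrite JE poweR_EFin [fine _]/=.
have J0 : 0 <= J by apply: Rintegral_ge0 => s _; exact: powR_ge0.
have t20 : 0 <= t / 2 by lra.
pose n := Num.truncn (t / 2).
have := truncn_itv t20; rewrite -/n -[X in _ < X]natr1 => /andP[n1 n2].
(* either the first [k] periods contract, or at least [k] periods remain below [M] *)
pose k := n./2.
have k2n : (k.*2 <= n)%N by rewrite -[leqRHS]odd_double_half leq_addl.
have kt : t / 4 - 1 <= k%:R.
  have : (n <= k * 2 + 1)%N.
    by rewrite -[leqLHS]odd_double_half -/k muln2 addnC leq_add2l; case: odd.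
  rewrite -(ler_nat R) natrD natrM => nk.
  by lra.
have [hA hB] := decay_le_rates kl M0 c0 c1 kt.
pose A := (1 - c) ^+ k + beta M (k%:R * 2) / M; pose B := beta M (k%:R * 2).
have B0 : 0 <= B by apply: KL_ge0 kl _ _ _ _; [exact: ltW|rewrite mulr_ge0].
have A0 : 0 <= A by rewrite addr_ge0 ?divr_ge0 ?exprn_ge0 ?subr_ge0// ltW.
pose Psi (s : R) := (A `^ p * `|g s| `^ p + Num.min `|g s| B `^ p)%:E.
have Psi0 s : (0 <= Psi s)%E by rewrite lee_fin addr_ge0 ?mulr_ge0 ?powR_ge0.
have mPsi : measurable_fun (`]-1, 1[%classic : set R) Psi.
  apply/measurable_EFinP; apply: measurable_funD.
    by apply: measurable_funM => //; apply: measurable_norm_powR; exact: mg.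
  apply: (measurableT_comp (measurable_powR _)).
  by apply: measurable_minr => //; apply: measurableT_comp => //; exact: mg.
have tauE : 0 <= t - n%:R * 2 <= 2 by apply/andP; split; lra.
have n0 : 0 <= n%:R :> R by [].
have mh : measurable_fun (`](n%:R * 2) - 1, (n%:R * 2) + 3[%classic : set R)
    (fun s => (`|g s| `^ p)%:E).
  apply: measurable_norm_powR_EFin; have /mg : -1 < n%:R * 2 + 3 :> R by lra.
  apply: measurable_funS => // y /=; rewrite !in_itv/= => /andP[? ?].
  by apply/andP; split; lra.
(* the window at time [t] meets the periods [n] and [n.+1] only *)
have win : (\int[@lebesgue_measure R]_(s in `](t - 1)%R, (t + 1)%R[) (`|g s| `^ p)%R%:E <=
    \int[@lebesgue_measure R]_(s in `](-1)%R, 1%R[) Psi s)%E.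
  have := window_integral_le tauE mh (fun s => _) mPsi Psi0 _.
  rewrite (_ : n%:R * 2 + (t - n%:R * 2) = t); last ring.
  apply; first by move=> s; rewrite lee_fin powR_ge0.
  apply: (ae_mono traj) => s H /H{}H.
  have dec m : (k.*2 <= m)%N -> `|g (s + m%:R * 2)| `^ p <=
      A `^ p * `|g s| `^ p + Num.min `|g s| B `^ p.
    move=> km; apply: decay_powR => //; first exact: ltW.
    by have := trajectory_decay kl M0 c1 dis contr bd H km; rewrite mul0r addr0.
  rewrite !lee_fin; split; first exact: dec.
  have := dec n.+1 (leqW k2n); rewrite -natr1.
  by rewrite (_ : (n%:R + 1) * 2 = n%:R * 2 + 2 :> R)//; ring.
have tot := le_trans win (majorant_integral_le (ltW p0) A0 B0 (mg _ ltN11) iJ erefl).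
have E0 : 0 <= J `^ p^-1 by exact: powR_ge0.
apply: (@le_trans _ _ ((A `^ p * J + Num.min J (2 * B `^ p)) `^ p^-1)%:E).
  rewrite -poweR_EFin; apply: gt0_ler_poweR; rewrite ?invr_ge0 ?(ltW p0)// in_itv/= leey andbT.
    by apply: integral_ge0 => s _; rewrite lee_fin powR_ge0.
  rewrite lee_fin; apply: addr_ge0; first by rewrite mulr_ge0 ?powR_ge0.
  by rewrite le_min J0/= mulr_ge0 ?powR_ge0.
rewrite lee_fin; apply: le_trans (Lp_rate_bound p1 A0 B0 J0) _.
rewrite /Lp_rate; apply: lerD; first by rewrite ler_wpM2r.
by rewrite le_min2// ler_pM2l.
Qed.
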